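(* Let $R=\mathbb Q[z]$, let $\mathcal E$ be the skein algebra of virtual knots, and let $\mathcal S_0$ be the set of non-trivial homotopy classes of virtual strings. There is a canonical $R$-algebra isomorphism $\nabla:\mathcal E\to R[\mathcal S_0]$, where $R[\mathcal S_0]$ is the polynomial algebra over $R$ generated by $\mathcal S_0$.
   Context: Virtual strings. For an integer $m\ge0$, a virtual string (string) $\alpha$ of rank $m$ is an oriented circle $S$ (the core circle) with $2m$ distinguished distinct points (the endpoints of $\alpha$) partitioned into $m$ ordered pairs, called the arrows; for an arrow $(a,b)$, $a$ is its tail and $b$ its head. A homeomorphism of strings is an orientation-preserving homeomorphism of the core circles carrying the set of arrows of the first string onto the set of arrows of the second. A trivial string has no arrows. For distinct $a,b\in S$, $ab$ denotes the arc of $S$ going from $a$ to $b$ in the positive direction. Homotopy of strings. The homotopy moves are as follows. $(a)_s$: for distinct $a,b\in S$ such that the arc $ab$ contains no endpoints of the string, add the arrow $(a,b)$. $(b)_s$: choose two arcs on $S$ disjoint from each other and from the endpoints of the string; let $a,a'$ be the endpoints of the first arc (in arbitrary order) and $b,b'$ those of the second arc (in arbitrary order); add the arrows $(a,b)$ and $(b',a')$. $(c)_s$: if the string has three arrows $(a^+,b),(b^+,c),(c^+,a)$ such that the arcs $aa^+,bb^+,cc^+$ are disjoint from each other and from the other endpoints of the string, replace these arrows with $(a,b^+),(b,c^+),(c,a^+)$. Two strings are homotopic if they are related by a finite sequence of homeomorphisms, these moves and the inverse moves; a string is homotopically trivial if it is homotopic to a trivial string. $\mathcal S_0$ is the set of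 homotopy classes of homotopically non-trivial strings. Virtual knots. An arrow diagram is a virtual string whose arrows are endowed with signs $\pm$; homeomorphisms of arrow diagrams are homeomorphisms of the underlying strings preserving the signs of all arrows. Moves on arrow diagrams: $(a)_{ad}$: for distinct $a,b\in S$ such that the arc $ab$ contains no endpoints, add the arrow $(a,b)$ with sign $+$ or $-$. $(b)_{ad}$: same as $(b)_s$, the two added arrows $(a,b)$ and $(b',a')$ having opposite signs. $(c)_{ad}$: if there are three arrows with signs $((a^+,b),+),((b^+,c),+),((c^+,a),-)$ such that the arcs $aa^+,bb^+,cc^+$ are disjoint from each other and from the other endpoints, replace them with $((a,b^+),+),((b,c^+),+),((c,a^+),-)$. A virtual knot is an equivalence class of arrow diagrams under the equivalence relation generated by these moves and homeomorphisms; $[D]$ denotes the virtual knot represented by an arrow diagram $D$. The trivial virtual knot is the one represented by the arrow diagram with no arrows. $\mathcal K$ is the set of virtual knots. Skein algebra. $R[\mathcal K]$ is the (commutative, associative, unital) polynomial algebra over $R$ generated by $\mathcal K$. For an arrow diagram $D$ with core circle $S$ and an arrow $e=(a,b)$ of $D$ with sign $+$, let $D^-_e$ be the same arrow diagram with the sign of $e$ changed to $-$; let $D'_e$ be the arrow diagram obtained from $D$ by removing all arrows with at least one endpoint on the arc $ba\subset S$; let $D''_e$ be the arrow diagram obtained from $D$ by removing all arrows with at least one endpoint on the arc $ab\subset S$. The skein relation corresponding to $(D,e)$ is the element $[D]-[D^-_e]-z[D'_e][D''_e]$ of $R[\mathcal K]$. The skein algebra of virtual knots $\mathcal E$ is the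 quotient of $R[\mathcal K]$ by the ideal generated by the trivial virtual knot and the skein relations corresponding to all such pairs $(D,e)$. *)

(* Defs.v *)
From HB Require Import structures.
From Stdlib Require Import Relations.
From mathcomp Require Import all_boot all_order all_algebra.
From mathcomp Require Import boolp.
From mathcomp Require Import monalg.

Set Implicit Arguments.
Unset Strict Implicit.
Unset Printing Implicit Defensive.

Import GRing.Theory.

Local Open Scope ring_scope.
Local Open Scope quotient_scope.

(* Virtual strings are encoded by Gauss words: arrows are labelled by natural
   numbers, and the endpoints on the core circle are listed in the positive
   direction, starting from an arbitrary base point which is not an endpoint.
   The endpoint (i, true) is the tail of the arrow i, (i, false) its head. *)
Definition endpoint := (nat * bool)%type.
Definition arrow_tail (i : nat) : endpoint := (i, true).
Definition arrow_head (i : nat) : endpoint := (i, false).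

Definition gauss (w : seq endpoint) : bool :=
  uniq w && all (fun x : endpoint => (x.1, ~~ x.2) \in w) w.

Record vstring := VString {
  endpoints :> seq endpoint;
  endpointsP : gauss endpoints }.

HB.instance Definition _ := [isSub for endpoints].
HB.instance Definition _ := [Choice of vstring by <:].

Definition trivial_string : vstring := @VString [::] isT.

(* The rotation accounts for the choice of the base points. *)
Definition homeo (f : nat -> nat) (v w : seq endpoint) : Prop :=
  (forall i j, arrow_tail i \in v -> arrow_tail j \in v -> f i = f j -> i = j) /\
  exists n, w = rot n [seq (f x.1, x.2) | x <- v].

(* The three moves, the base point being placed (by a homeomorphism) just
   before the arc ab in (a), just before the first of the two arcs in (b), and
   just before the arc aa^+ in (c). That the added arrows are new in (a) and (b)
   follows from both words being Gauss words. *)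
Definition move_a (i : nat) (v w : seq endpoint) : Prop :=
  w = [:: arrow_tail i; arrow_head i] ++ v.

(* i is the arrow (a, b) and j is the arrow (b', a'). *)
Definition move_b (i j : nat) (v w : seq endpoint) : Prop :=
  exists (s t x y : seq endpoint),
    [/\ perm_eq s [:: arrow_tail i; arrow_head j], perm_eq t [:: arrow_head i; arrow_tail j],
        v = x ++ y & w = s ++ x ++ t ++ y].

(* i, j, k are the arrows (a^+, b), (b^+, c), (c^+, a) in v, and the arrows
   (a, b^+), (b, c^+), (c, a^+) in w. The two cases are the two possible cyclic
   orders of the arcs aa^+, bb^+, cc^+ on the core circle. *)
Definition move_c (i j k : nat) (v w : seq endpoint) : Prop :=
  exists x y t : seq endpoint,
    (v = [:: arrow_head k; arrow_tail i] ++ x ++ [:: arrow_head i; arrow_tail j] ++ y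
           ++ [:: arrow_head j; arrow_tail k] ++ t /\
     w = [:: arrow_tail i; arrow_head k] ++ x ++ [:: arrow_tail j; arrow_head i] ++ y
           ++ [:: arrow_tail k; arrow_head j] ++ t) \/
    (v = [:: arrow_head k; arrow_tail i] ++ x ++ [:: arrow_head j; arrow_tail k] ++ y
           ++ [:: arrow_head i; arrow_tail j] ++ t /\
     w = [:: arrow_tail i; arrow_head k] ++ x ++ [:: arrow_tail k; arrow_head j] ++ y
           ++ [:: arrow_tail j; arrow_head i] ++ t).

Variant string_step (v w : vstring) : Prop :=
| StringHomeo f of homeo f v w
| StringMoveA i of move_a i v w
| StringMoveB i j of move_b i j v w
| StringMoveC i j k of move_c i j k v w.

Definition homotopic : vstring -> vstring -> Prop :=
  clos_refl_sym_trans vstring string_step.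

Definition homotopicb : rel vstring := fun v w => `[< homotopic v w >].

Lemma homotopicb_equiv : equiv_class_of homotopicb.
Proof.
split=> [v|v w|v u w]; first exact/asboolP/rst_refl.
- by apply/asboolP/asboolP => /(rst_sym _ _ _ _).
- by move=> /asboolP uv /asboolP vw; apply/asboolP/(rst_trans _ _ _ _ _ uv vw).
Qed.
Canonical homotopicb_equivRel := EquivRelPack homotopicb_equiv.

Definition string_class := {eq_quot homotopicb}.
HB.instance Definition _ := Choice.on string_class.
HB.instance Definition _ := EqQuotient.on string_class.

Definition nontrivial_string_class :=
  {c : string_class | c != \pi_string_class trivial_string}.
HB.instance Definition _ := Choice.on nontrivial_string_class.

(* The arrow i of an arrow diagram D is positive when sign D i is true; the
   values of sign D at numbers that are not arrows of D are irrelevant. *)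
Record diagram := Diagram {
  underlying :> vstring;
  sign : nat -> bool }.

HB.instance Definition _ := gen_eqMixin diagram.
HB.instance Definition _ := gen_choiceMixin diagram.

Definition same_signs (D D' : diagram) : Prop :=
  forall i, arrow_tail i \in endpoints D -> sign D' i = sign D i.

Variant diagram_step (D D' : diagram) : Prop :=
| DiagramHomeo f of homeo f D D'
    & (forall i, arrow_tail i \in endpoints D -> sign D' (f i) = sign D i)
| DiagramMoveA i of move_a i D D' & same_signs D D'
| DiagramMoveB i j of move_b i j D D' & same_signs D D'
    & sign D' j = ~~ sign D' i
| DiagramMoveC i j k of move_c i j k D D' & same_signs D D'
    & [/\ sign D i = true, sign D j = true & sign D k = false].

Definition knot_equiv : diagram -> diagram -> Prop :=
  clos_refl_sym_trans diagram diagram_step.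

Definition knot_equivb : rel diagram := fun D D' => `[< knot_equiv D D' >].

Lemma knot_equivb_equiv : equiv_class_of knot_equivb.
Proof.
split=> [v|v w|v u w]; first exact/asboolP/rst_refl.
- by apply/asboolP/asboolP => /(rst_sym _ _ _ _).
- by move=> /asboolP uv /asboolP vw; apply/asboolP/(rst_trans _ _ _ _ _ uv vw).
Qed.
Canonical knot_equivb_equivRel := EquivRelPack knot_equivb_equiv.

Definition virtual_knot := {eq_quot knot_equivb}.
HB.instance Definition _ := Choice.on virtual_knot.
HB.instance Definition _ := EqQuotient.on virtual_knot.

Definition trivial_knot : virtual_knot :=
  \pi_virtual_knot (Diagram trivial_string (fun=> true)).

Definition negate_sign (D : diagram) (e : nat) : diagram :=
  Diagram D [eta sign D with e |-> false].

(* The endpoints met on the arc xy, including x and y (path.arc omits y). *)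
Definition closed_arc (w : seq endpoint) (x y : endpoint) : seq endpoint :=
  rcons (arc w x y) y.

Definition remove_word (s w : seq endpoint) : seq endpoint :=
  [seq x <- w | (arrow_tail x.1 \notin s) && (arrow_head x.1 \notin s)].

Lemma remove_wordP s w : gauss w -> gauss (remove_word s w).
Proof.
case/andP=> uw /allP hw; apply/andP; split; first exact: filter_uniq.
by apply/allP=> x; rewrite !mem_filter /= => /andP[-> /hw].
Qed.

(* Removal of all the arrows with at least one endpoint in s. *)
Definition remove_arrows (s : seq endpoint) (D : diagram) : diagram :=
  Diagram (VString (remove_wordP s (endpointsP D))) (sign D).

Definition skein_left (D : diagram) (e : nat) : diagram :=
  remove_arrows (closed_arc D (arrow_head e) (arrow_tail e)) D.

Definition skein_right (D : diagram) (e : nat) : diagram :=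
  remove_arrows (closed_arc D (arrow_tail e) (arrow_head e)) D.

(* The ground ring is Q[z], and z is 'X. *)
Notation polyalg T := {malg {poly rat}[{cmonom T}]}.

Definition gen (T : choiceType) (x : T) : polyalg T := << ucm x >>.

Definition knot_gen (D : diagram) : polyalg virtual_knot :=
  gen (\pi_virtual_knot D).

Definition skein_relation (D : diagram) (e : nat) : polyalg virtual_knot :=
  knot_gen D - knot_gen (negate_sign D e)
  - 'X *: (knot_gen (skein_left D e) * knot_gen (skein_right D e)).

Variant skein_generator : polyalg virtual_knot -> Prop :=
| SkeinTrivial : skein_generator (gen trivial_knot)
| SkeinRelation (D : diagram) e of arrow_tail e \in endpoints D & sign D e = true :
    skein_generator (skein_relation D e).

Definition generated_ideal (A : comNzRingType) (G : A -> Prop) : {pred A} :=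
  fun x => `[< exists s : seq (A * A),
    (forall p, p \in s -> G p.2) /\ x = \sum_(p <- s) p.1 * p.2 >].

Lemma generated_ideal_closed (A : comNzRingType) (G : A -> Prop) :
  1 \notin generated_ideal G -> idealr_closed (generated_ideal G).
Proof.
move=> G1; split=> // [|a u v /asboolP[s [sG ->]] /asboolP[t [tG ->]]].
  by apply/asboolP; exists [::]; rewrite big_nil.
apply/asboolP; exists ([seq (a * p.1, p.2) | p <- s] ++ t); split=> [p|].
  by rewrite mem_cat => /orP[/mapP[q qs ->]|/tG //]; exact: sG qs.
rewrite big_cat big_map /= mulr_sumr; congr (_ + _).
by apply: eq_bigr => p _; rewrite mulrA.
Qed.

Definition skein_ideal : {pred polyalg virtual_knot} :=
  generated_ideal skein_generator.

Lemma mcoeff1_gen (T : choiceType) (x : T) : (gen x)@_mone = 0.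
Proof.
by rewrite mcoeffU; case: eqP => // /eqP/cmP/(_ x); rewrite cmUU cm1.
Qed.

Lemma mcoeff1M (T : choiceType) (x y : polyalg T) :
  (x * y)@_mone = x@_mone * y@_mone.
Proof. exact: (mcoeff1g_is_multiplicative _ _).1. Qed.

Lemma mcoeff1_sum (T : choiceType) (s : seq (polyalg T * polyalg T)) :
  (forall p, p \in s -> p.2@_mone = 0) ->
  (\sum_(p <- s) p.1 * p.2)@_mone = 0.
Proof.
elim: s => [|p s IHs] sG; first by rewrite big_nil mcoeff0.
rewrite big_cons mcoeffD mcoeff1M sG ?mem_head // mulr0 add0r IHs // => q qs.
by apply: sG; rewrite inE qs orbT.
Qed.

Lemma mcoeff1_skein (T : choiceType) (x y u v : polyalg T) (a : {poly rat}) :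
  x@_mone = 0 -> y@_mone = 0 -> u@_mone = 0 ->
  (x - y - a *: (u * v))@_mone = 0.
Proof.
by move=> x0 y0 u0; rewrite !mcoeffB mcoeffZ mcoeff1M x0 y0 u0 mul0r mulr0 !subr0.
Qed.

Lemma skein_generator_mcoeff1 x : skein_generator x -> x@_mone = 0.
Proof.
by case=> [|D e _ _]; [|apply: mcoeff1_skein]; apply: mcoeff1_gen.
Qed.

Lemma skein_ideal_closed : idealr_closed skein_ideal.
Proof.
apply: generated_ideal_closed; apply/asboolP => -[s [sG]].
move=> /(congr1 (mcoeff mone)).
rewrite mcoeff1_sum => [/eqP|p ps]; last exact/skein_generator_mcoeff1/sG.
by rewrite mcoeff1 eqxx oner_eq0.
Qed.
HB.instance Definition _ :=
  isIdealr.Build (polyalg virtual_knot) skein_ideal skein_ideal_closed.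

Definition skein_algebra := {ideal_quot skein_ideal}.
HB.instance Definition _ := GRing.ComNzRing.on skein_algebra.
HB.instance Definition _ := EqQuotient.on skein_algebra.

Definition skein_scale (a : {poly rat}) (x : skein_algebra) : skein_algebra :=
  \pi_skein_algebra a%:A * x.

Lemma pi_skeinZ a (x : polyalg virtual_knot) :
  \pi_skein_algebra (a *: x) = skein_scale a (\pi_skein_algebra x).
Proof. by rewrite /skein_scale -rmorphM mulr_algl. Qed.

Lemma skein_scaleA a b x : skein_scale a (skein_scale b x) = skein_scale (a * b) x.
Proof. by rewrite -[x]reprK -!pi_skeinZ scalerA. Qed.

Lemma skein_scale1 : left_id 1 skein_scale.
Proof. by move=> x; rewrite -[x]reprK -pi_skeinZ scale1r. Qed.

Lemma skein_scaleDr : right_distributive skein_scale +%R.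
Proof. by move=> a x y; rewrite /skein_scale mulrDr. Qed.

Lemma skein_scaleDl x : {morph skein_scale^~ x : a b / a + b}.
Proof. by move=> a b; rewrite /skein_scale scalerDl rmorphD mulrDl. Qed.

HB.instance Definition _ := GRing.Zmodule_isLmodule.Build {poly rat} skein_algebra
  skein_scaleA skein_scale1 skein_scaleDr skein_scaleDl.

Lemma skein_scaleAl a (x y : skein_algebra) : a *: (x * y) = (a *: x) * y.
Proof. exact: mulrA. Qed.

HB.instance Definition _ :=
  GRing.Lmodule_isLalgebra.Build {poly rat} skein_algebra skein_scaleAl.
HB.instance Definition _ :=
  GRing.Lalgebra_isComAlgebra.Build {poly rat} skein_algebra.

Definition skein_class (D : diagram) : skein_algebra :=
  \pi_skein_algebra (knot_gen D).

Notation string_algebra := (polyalg nontrivial_string_class).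

(* The class of v as an element of R[S_0], homotopically trivial strings being
   sent to 0. *)
Definition string_gen (v : vstring) : string_algebra :=
  if insub (\pi_string_class v) is Some c then gen c else 0.

(* Main.v *)
Require Import Defs.
From HB Require Import structures.
From Stdlib Require Import Relations.
From mathcomp Require Import all_boot all_order all_algebra.
From mathcomp Require Import boolp finmap.
From mathcomp Require Import monalg.
From mathcomp Require Import ring zify.

Set Implicit Arguments.
Unset Strict Implicit.
Unset Printing Implicit Defensive.

Import GRing.Theory.
Local Open Scope ring_scope.
Local Open Scope quotient_scope.

(** The proof compares knots with strings through a state sum.  Cut a diagram
    at a set of pairwise unlinked arrows.  The core circle falls apart into
    components, which are the vertices of a tree whose edges are the cut
    arrows; an arrow whose endpoints lie on different components is discarded.
    Give the components independent uniform labels in [0, 1].  A positive cut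
    arrow (a, b) requires that the component on the side of the arc ab has the
    larger label; a negative one requires the opposite and contributes a factor
    -1.  The state sum of the diagram, for a function psi of strings, is the sum
    over all sets of cuts of z to the number of cuts, times the sign, times the
    probability that the requirements hold, times the product of the values of
    psi on the components.  The probability is the number of linear extensions
    of a poset divided by a factorial, which is why the coefficients are
    rational.

    Changing the sign of an arrow e changes the state sum by the terms in which e
    is cut; the requirements for e as a positive and as a negative arrow are
    complementary, so these terms add up to a product of two independent state
    sums.  This is the skein relation ([state_sum_skein]).

    If psi is a homotopy invariant that vanishes on the trivial string, the
    state sum is an invariant of virtual knots.  In move (a), cutting the new
    arrow splits off a trivial component ([state_sum_kink]).  In move (b), the
    two arrows have opposite signs and cutting either one splits off the same
    component, while cutting both leaves a trivial component in between
    ([expand_slide]).  In move (c), on the side where the three arrows are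
    pairwise unlinked, cutting two of them yields the same three components for
    each of the three pairs, joined in three different ways; the three terms
    cancel because two labels above a third one are ordered in one of two ways
    ([cut_triangle], [state_sum_triangle]).  The state sum of the homotopy class
    of strings therefore induces a morphism nabla on the skein algebra.  The
    empty set of cuts contributes the underlying string itself, and every other
    term is divisible by z.

    The inverse comes from reading the same formula backwards.  Every term
    except the leading one involves fewer arrows, so there is exactly one
    function [string_lift] from strings to the skein algebra whose state sums
    are the classes of the positive diagrams, and then, by the skein relation,
    of all diagrams ([knot_sum_lift]).  Its homotopy invariance follows by
    induction on the number of arrows: the above cancellations, applied to the
    components with fewer arrows, say that a move changes the state sum by the
    change of the leading term, whereas the class of the diagram does not
    change.  Both composites are identities because the state sums of a function
    of strings determine that function ([eq_of_knot_sum]).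

    The trees are not constructed.  A word is read from its base point, and
    [expand] is a polynomial in the label of the component that contains the
    base point; a component that is split off enters through the integral of
    its own polynomial over the labels allowed by the cut.  Independence of the
    base point is then integration by parts. *)

(** * Integration of polynomials over the unit interval *)

Section Integration.
Variable B : comAlgType {poly rat}.
Implicit Types p q : {poly B}.

Definition integ_below p : {poly B} :=
  \poly_(i < (size p).+1)
    (if i is j.+1 then (j.+1%:R^-1 : rat)%:P *: p`_j else 0).

Definition mean p : B := (integ_below p).[1].

Definition integ_above p : {poly B} := (mean p)%:P - integ_below p.

Lemma scale_natVK n (x : B) : ((n.+1%:R^-1 : rat)%:P *: x) *+ n.+1 = x.
Proof.
rewrite -scaler_nat scalerA -polyC_natr -polyCM mulfV ?scale1r //.
by rewrite Num.Theory.pnatr_eq0.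
Qed.

Lemma coef_integ_below p i :
  (integ_below p)`_i = if i is j.+1 then (j.+1%:R^-1 : rat)%:P *: p`_j else 0.
Proof.
rewrite coef_poly; case: i => [|j]; first by rewrite ltn0Sn.
by rewrite ltnS; case: ltnP => // le_p_j; rewrite nth_default // scaler0.
Qed.

Lemma deriv_integ_below p : (integ_below p)^`() = p.
Proof. by apply/polyP=> i; rewrite coef_deriv coef_integ_below scale_natVK. Qed.

Lemma deriv_inj p q : p`_0 = q`_0 -> p^`() = q^`() -> p = q.
Proof.
move=> eq0 /polyP eqd; apply/polyP=> -[|i] //; have := eqd i.
rewrite !coef_deriv => /(congr1 (fun x => (i.+1%:R^-1 : rat)%:P *: x)).
by rewrite -!scalerMnr !scale_natVK.
Qed.

Lemma integ_belowD p q : integ_below (p + q) = integ_below p + integ_below q.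
Proof.
by apply/polyP=> -[|i]; rewrite !(coefD, coef_integ_below) ?addr0 // scalerDr.
Qed.

Lemma integ_belowCM (c : B) p : integ_below (c%:P * p) = c%:P * integ_below p.
Proof.
apply/polyP=> -[|i]; rewrite !(coefCM, coef_integ_below) ?mulr0 //.
by rewrite scalerAr.
Qed.

Lemma integ_belowN p : integ_below (- p) = - integ_below p.
Proof. by rewrite -mulN1r -polyCN integ_belowCM polyCN mulN1r. Qed.

Lemma integ_below0 : integ_below 0 = 0.
Proof. by apply: (addrI (integ_below 0)); rewrite -integ_belowD !addr0. Qed.

(** Two independent labels below u are ordered in one of two ways; formally, this is
    integration by parts. *)
Lemma integ_belowM p q : integ_below p * integ_below q =
  integ_below (p * integ_below q) + integ_below (integ_below p * q).
Proof.
apply: deriv_inj; last by rewrite derivM derivD !deriv_integ_below.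
by rewrite coefM coefD big_ord1 !coef_integ_below mul0r addr0.
Qed.

Lemma meanD p q : mean (p + q) = mean p + mean q.
Proof. by rewrite /mean integ_belowD hornerD. Qed.

Lemma meanCM (c : B) p : mean (c%:P * p) = c * mean p.
Proof. by rewrite /mean integ_belowCM hornerCM. Qed.

Lemma meanN p : mean (- p) = - mean p.
Proof. by rewrite /mean integ_belowN hornerN. Qed.

Lemma mean0 : mean 0 = 0.
Proof. by rewrite /mean integ_below0 horner0. Qed.

Lemma meanC (c : B) : mean c%:P = c.
Proof.
rewrite -[c%:P]mulr1 meanCM -[RHS]mulr1; congr (_ * _).
rewrite /mean; suff ->: integ_below 1 = 'X by rewrite hornerX.
apply: deriv_inj; rewrite ?deriv_integ_below ?derivX //.
by rewrite coef_integ_below coefX.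
Qed.

Lemma mean_integ_belowM p q : mean (p * integ_below q) + mean (integ_below p * q) = mean p * mean q.
Proof. by rewrite /mean -hornerD -integ_belowM hornerM. Qed.

(** Fubini: a label above a second one, and a label below which the first one lies. *)
Lemma mean_above p q : mean (integ_above p * q) = mean (p * integ_below q).
Proof.
by rewrite mulrBl meanD meanN meanCM -mean_integ_belowM addrK.
Qed.

Lemma integ_aboveD p q : integ_above (p + q) = integ_above p + integ_above q.
Proof. by rewrite /integ_above meanD integ_belowD polyCD; ring. Qed.

Lemma integ_aboveCM (c : B) p : integ_above (c%:P * p) = c%:P * integ_above p.
Proof. by rewrite /integ_above meanCM integ_belowCM polyCM mulrBr. Qed.

Lemma integ_aboveN p : integ_above (- p) = - integ_above p.
Proof. by rewrite /integ_above meanN integ_belowN polyCN opprD. Qed.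

Lemma integ_aboveM p q :
  integ_above p * integ_above q =
  integ_above (integ_above p * q + p * integ_above q).
Proof.
have ->: integ_above p * q + p * integ_above q =
    (mean p)%:P * q + (mean q)%:P * p - (p * integ_below q + integ_below p * q).
  by rewrite /integ_above; ring.
rewrite !integ_aboveD integ_aboveN !integ_aboveCM /integ_above meanD mean_integ_belowM.
by rewrite integ_belowD -integ_belowM polyCM; ring.
Qed.

End Integration.

(** * Gauss words and their expansion *)

Definition mate (e : endpoint) : endpoint := (e.1, ~~ e.2).

Lemma mateK : involutive mate.
Proof. by case=> i b; rewrite /mate /= negbK. Qed.

Lemma mate_eq e f : (mate e == f) = (e == mate f).
Proof. by rewrite -(inj_eq (inv_inj mateK)) mateK. Qed.

Lemma mate_neq e : (mate e == e) = false.
Proof. by case: e => i []; apply/negbTE/eqP => -[]. Qed.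

Lemma split_first (x : endpoint) (s : seq endpoint) :
  x \in s -> exists s1 s2 : seq endpoint, s = s1 ++ x :: s2 /\ x \notin s1.
Proof.
elim: s => //= y s IHs; rewrite inE; have [-> _|neq /=] := eqVneq x y.
  by exists [::], s.
by case/IHs=> s1 [s2 [-> xs1]]; exists (y :: s1), s2; rewrite inE negb_or neq.
Qed.

Section Expansion.
Variable B : comAlgType {poly rat}.
Implicit Types (wt : nat -> option bool) (g G : seq endpoint -> B).
Implicit Types (e : endpoint) (s : seq endpoint).

(** The factor contributed by cutting the arrow of [e], where u is the label of the
    component being read, and the component split off starts after [e] and has
    polynomial [p].  The value [None] forbids the cut; it serves to isolate the terms
    in which a given arrow is not cut. *)
Definition cut wt e (p : {poly B}) : {poly B} :=
  if wt e.1 is Some b then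
    ('X%:A)%:P * (-1) ^+ (~~ b) * (if b == e.2 then integ_above p else integ_below p)
  else 0.

(** The base point lies on the component being read: its label is the indeterminate,
    and its word is handed to [G] endpoint by endpoint, while the components that are
    split off are valued by [g].  Endpoints whose mate has been cut away stay in the
    words, so [g] and [G] have to ignore them (see [droppable]).  The recursion is on
    the length [n], as the two arcs of a cut are not subterms. *)
Fixpoint expand_rec n wt g G s : {poly B} :=
  if n is n'.+1 then
    if s is e :: s' then
      expand_rec n' wt g (fun q => G (e :: q)) s' +
      (if mate e \in s' then
         cut wt e (expand_rec n' wt g g (take (index (mate e) s') s'))
         * expand_rec n' wt g G (drop (index (mate e) s').+1 s')
       else 0)
    else (G [::])%:P
  else (G [::])%:P.

Definition expand wt g G s := expand_rec (size s) wt g G s.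

Lemma expand_recE n wt g G s : (size s <= n)%N ->
  expand_rec n wt g G s = expand wt g G s.
Proof.
rewrite /expand; have [k] := ubnP (size s).
elim: k n s G => // k IHk n s G lek len.
case: s lek len => [|e s] /=; first by case: n.
case: n => // n; rewrite !ltnS => lek len /=.
have le_t i : (size (take i s) <= size s)%N by rewrite size_take_min geq_minr.
have le_d i : (size (drop i s) <= size s)%N by rewrite size_drop leq_subr.
rewrite IHk //; congr (_ + _); case: ifP => // _.
rewrite [expand_rec n _ _ _ (take _ _)]IHk ?(leq_trans (le_t _)) ?(leq_ltn_trans (le_t _)) //.
rewrite [expand_rec n _ _ _ (drop _ _)]IHk ?(leq_trans (le_d _)) ?(leq_ltn_trans (le_d _)) //.
congr (cut _ _ _ * _); symmetry; apply: IHk;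
  by rewrite ?le_t ?le_d ?(leq_ltn_trans (le_t _)) ?(leq_ltn_trans (le_d _)).
Qed.

Lemma expand_nil wt g G : expand wt g G [::] = (G [::])%:P.
Proof. by []. Qed.

Lemma expand_cut wt g G e s1 s2 : mate e \notin s1 ->
  expand wt g G (e :: s1 ++ mate e :: s2) =
  expand wt g (fun q => G (e :: q)) (s1 ++ mate e :: s2)
  + cut wt e (expand wt g g s1) * expand wt g G s2.
Proof.
move=> es1; rewrite {1}/expand /=; congr (_ + _).
rewrite mem_cat mem_head orbT index_cat (negbTE es1) /= eqxx addn0.
rewrite take_size_cat // drop_cat ltnNge leqnSn /= subSn // subnn /= drop0.
by rewrite !expand_recE // size_cat /=; lia.
Qed.

Lemma cut_None wt e p : wt e.1 = None -> cut wt e p = 0.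
Proof. by rewrite /cut => ->. Qed.

Lemma expand_keep wt g G e s : wt e.1 = None \/ mate e \notin s ->
  expand wt g G (e :: s) = expand wt g (fun q => G (e :: q)) s.
Proof.
case=> [we|es]; last by rewrite {1}/expand /= (negbTE es) addr0.
case: (boolP (mate e \in s)) => es.
  have [s1 [s2 [-> es1]]] := split_first es.
  by rewrite expand_cut // cut_None // mul0r addr0.
by rewrite {1}/expand /= (negbTE es) addr0.
Qed.

Lemma cut0 wt e : cut wt e 0 = 0.
Proof.
rewrite /cut; case: (wt _) => // b.
by rewrite /integ_above mean0 integ_below0 subr0 if_same mulr0.
Qed.

(** The base point may be moved across an endpoint whose arrow cannot be cut. *)
Lemma expand_rcons_inert wt g G s e : mate e \notin s ->
  expand wt g G (rcons s e) = expand wt g (fun q => G (rcons q e)) s.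
Proof.
have [k] := ubnP (size s); elim: k s G => // k IHk [|f s] G /=.
  by move=> _ _; rewrite expand_keep //; right.
rewrite ltnS inE negb_or => lek /andP[ef es].
have [fs|fs] := boolP (mate f \in s); last first.
  rewrite expand_keep ?IHk ?expand_keep //; first by right.
  by right; rewrite mem_rcons inE negb_or fs mate_eq eq_sym ef.
have [s1 [s2 [defs fs1]]] := split_first fs; rewrite -> defs in *.
have [es1 es2] : mate e \notin s1 /\ mate e \notin s2.
  by move: es; rewrite mem_cat inE !negb_or => /and3P[].
move: (lek); rewrite size_cat /= => lek'.
rewrite rcons_cat rcons_cons expand_cut // expand_cut // -rcons_cons -rcons_cat.
rewrite IHk // IHk //; lia.
Qed.

(** If the arrow of the last endpoint is cut, the component with the base point is the
    initial piece, and the arc between the two endpoints is split off. *)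
Lemma expand_rcons_cut wt g G s1 s2 e : uniq (s1 ++ mate e :: rcons s2 e) ->
  expand wt g G (s1 ++ mate e :: rcons s2 e) =
  expand wt g (fun q => G (rcons q e)) (s1 ++ mate e :: s2)
  + expand wt g G s1 * cut wt (mate e) (expand wt g g s2).
Proof.
have [k] := ubnP (size s1); elim: k s1 s2 G => // k IHk [|f s1] s2 G /=.
  move=> _; rewrite rcons_uniq mem_rcons inE negb_or => /and3P[/andP[_ es] e's us].
  rewrite -{1}cats1 -{2}(mateK e) expand_cut ?mateK // expand_nil.
  rewrite mulrC cats1 expand_rcons_inert // expand_keep ?mateK //.
  by right.
rewrite ltnS => lek /andP[fs us].
have [/andP[ne1 ne2]] : (f != e) && (f != mate e).
  move: fs; rewrite !(mem_cat, inE, mem_rcons) !negb_or.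
  by case/and4P=> _ -> ->.
have [fs1|fs1] := boolP (mate f \in s1).
  have [u [r [defs fu]]] := split_first fs1; rewrite -> defs in *.
  move: us; rewrite -catA cat_cons => us.
  rewrite expand_cut // -cat_cons catA IHk //; last by rewrite -catA.
  rewrite IHk; last first.
  - by move: us; rewrite cat_uniq /= => /and4P[].
  - by move: lek; rewrite size_cat /=; lia.
  rewrite -catA cat_cons expand_cut // [expand _ _ _ (f :: _)]expand_cut //.
  ring.
have [fs2|fs2] := boolP (mate f \in s2).
  have [u [r [defs fu]]] := split_first fs2; rewrite -> defs in *.
  have -> : s1 ++ mate e :: rcons (u ++ mate f :: r) e =
     (s1 ++ mate e :: u) ++ mate f :: rcons r e.
    by rewrite rcons_cat -catA.
  have fsu : mate f \notin s1 ++ mate e :: u.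
    by rewrite mem_cat inE !negb_or fs1 fu (inj_eq (inv_inj mateK)) ne1.
  rewrite expand_cut //.
  have -> : (s1 ++ mate e :: u) ++ mate f :: rcons r e =
      s1 ++ mate e :: rcons (u ++ mate f :: r) e.
    by rewrite rcons_cat -catA.
  rewrite IHk // expand_rcons_inert; last first.
    move: us; rewrite rcons_cat cat_uniq /= => /and3P[_ _] /andP[+ _].
    by rewrite mem_cat inE mem_rcons !inE !negb_or => /and4P[].
  have -> : s1 ++ mate e :: u ++ mate f :: r =
     (s1 ++ mate e :: u) ++ mate f :: r by rewrite -catA.
  rewrite expand_cut // [expand _ _ _ (f :: _)]expand_keep; last by right.
  ring.
have fin x : x \notin s1 -> x \notin s2 -> x != mate e ->
   x \notin s1 ++ mate e :: s2.
  by rewrite mem_cat inE !negb_or => -> -> ->.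
have me : mate f != mate e by rewrite (inj_eq (inv_inj mateK)).
rewrite expand_keep; last first.
  right; rewrite !(mem_cat, inE, mem_rcons) !negb_or fs1 me fs2 mate_eq ne2 //.
rewrite IHk // [expand _ _ _ (f :: _ ++ _)]expand_keep; last by right; exact: fin.
by rewrite [expand _ _ _ (f :: s1)]expand_keep //; right.
Qed.

End Expansion.

(** * Comparing the expansions of two words *)

(** Two words are compared piece by piece: an item is either a pair of corresponding
    endpoints, or a pair of blocks that allow no cut and may be completely different. *)
Notation item := ((endpoint * endpoint) + (seq endpoint * seq endpoint))%type.

Definition lefts (s : seq item) : seq endpoint :=
  flatten [seq match t with inl p => [:: p.1] | inr p => p.1 end | t <- s].
Definition rights (s : seq item) : seq endpoint :=
  flatten [seq match t with inl p => [:: p.2] | inr p => p.2 end | t <- s].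

Lemma lefts_single c c' s : lefts (inl (c, c') :: s) = c :: lefts s.
Proof. by []. Qed.
Lemma rights_single c c' s : rights (inl (c, c') :: s) = c' :: rights s.
Proof. by []. Qed.
Lemma lefts_block b b' s : lefts (inr (b, b') :: s) = b ++ lefts s.
Proof. by []. Qed.
Lemma rights_block b b' s : rights (inr (b, b') :: s) = b' ++ rights s.
Proof. by []. Qed.

Lemma lefts_cat s t : lefts (s ++ t) = lefts s ++ lefts t.
Proof. by rewrite /lefts map_cat flatten_cat. Qed.
Lemma rights_cat s t : rights (s ++ t) = rights s ++ rights t.
Proof. by rewrite /rights map_cat flatten_cat. Qed.

Lemma lefts_sub s t : {subset s <= t} -> {subset lefts s <= lefts t}.
Proof. by move=> st x /flatten_mapP[i /st it xi]; apply/flatten_mapP; exists i. Qed.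
Lemma rights_sub s t : {subset s <= t} -> {subset rights s <= rights t}.
Proof. by move=> st x /flatten_mapP[i /st it xi]; apply/flatten_mapP; exists i. Qed.

Definition inert (wt : nat -> option bool) (b s : seq endpoint) : Prop :=
  forall x, x \in b -> wt x.1 = None \/ mate x \notin s.

Record parallel (wt wt' : nat -> option bool) (s : seq item) : Prop := Parallel {
  parallel_wt : forall a a', inl (a, a') \in s -> a.2 = a'.2 /\ wt a.1 = wt' a'.1;
  parallel_mate : forall a a' c c', inl (a, a') \in s -> inl (c, c') \in s ->
    (mate a == c) = (mate a' == c');
  parallel_inert : forall b b', inr (b, b') \in s ->
    inert wt b (lefts s) /\ inert wt' b' (rights s);
  parallel_block : forall a a' b b', inl (a, a') \in s -> inr (b, b') \in s ->
    mate a \notin b /\ mate a' \notin b' }.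

Lemma parallel_sub wt wt' s t : {subset s <= t} -> parallel wt wt' t -> parallel wt wt' s.
Proof.
move=> st [h1 h2 h3 h4]; split.
- by move=> a a' /st/h1.
- by move=> a a' c c' /st + /st; exact: h2.
- move=> b b' /st/h3[i1 i2]; split=> x xb.
    by case: (i1 x xb) => [|/negP nx]; [left|right; apply/negP=> /(lefts_sub st)].
  by case: (i2 x xb) => [|/negP nx]; [left|right; apply/negP=> /(rights_sub st)].
- by move=> a a' b b' /st + /st; exact: h4.
Qed.

Section Sim.
Variable B : comAlgType {poly rat}.
Implicit Types (wt : nat -> option bool) (g G : seq endpoint -> B).

Lemma expand_inert wt g G b s : inert wt b (b ++ s) ->
  expand wt g G (b ++ s) = expand wt g (fun q => G (b ++ q)) s.
Proof.
elim: b G => //= e b IHb G ib; rewrite expand_keep ?IHb //.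
  move=> x xb; have /ib[|] : x \in e :: b by rewrite inE xb orbT.
    by left.
  by rewrite inE negb_or => /andP[_ ?]; right.
have /ib[|] : e \in e :: b by rewrite mem_head.
  by left.
by rewrite inE negb_or => /andP[_ ?]; right.
Qed.

Lemma eq_cut wt wt' a a' (p : {poly B}) :
  wt a.1 = wt' a'.1 -> a.2 = a'.2 -> cut wt a p = cut wt' a' p.
Proof. by rewrite /cut => -> ->. Qed.

(** The mate of a corresponding pair is a corresponding pair, at the same place. *)
Lemma parallel_split wt wt' a a' s : parallel wt wt' (inl (a, a') :: s) ->
  (mate a \notin lefts s /\ mate a' \notin rights s) \/
  exists u r, [/\ s = u ++ inl (mate a, mate a') :: r,
    mate a \notin lefts u & mate a' \notin rights u].
Proof.
elim: s => [|t s IHs] par; first by left.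
have: parallel wt wt' (inl (a, a') :: s).
  by apply: parallel_sub par => x; rewrite !inE => /orP[->|->]; rewrite ?orbT.
move=> /IHs{IHs}; case: t par => [[c c']|[b b']] par.
  have eqc : (mate a == c) = (mate a' == c').
    by apply: (parallel_mate par); rewrite !inE !eqxx ?orbT.
  move=> IHs.
  have [ec|nc] : mate a = c \/ mate a != c by case: eqVneq; [left|right].
    right; exists [::], s; split=> //; rewrite ec eqxx in eqc.
    by rewrite -(eqP (esym eqc)) ec.
  have nc' : mate a' != c' by rewrite -eqc.
  case: IHs => [[l r]|[u [r [-> au a'u]]]].
    by left; rewrite lefts_single rights_single !inE !negb_or nc nc'.
  right; exists (inl (c, c') :: u), r; split=> //.
    by rewrite lefts_single inE negb_or nc.
  by rewrite rights_single inE negb_or nc'.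
have [] := parallel_block par (a:=a) (a':=a') (b:=b) (b':=b').
- by rewrite !inE eqxx.
- by rewrite !inE eqxx orbT.
move=> ab ab' [[l r]|[u [r [-> au a'u]]]].
  by left; rewrite lefts_block rights_block !mem_cat !negb_or ab ab'.
right; exists (inr (b, b') :: u), r; split=> //.
  by rewrite lefts_block mem_cat negb_or ab.
by rewrite rights_block mem_cat negb_or ab'.
Qed.

(** Cuts are possible at the same places of both words and split off corresponding
    components.  The whole word is handed to [G] only for the empty set of cuts, so a
    defect [d] there passes unchanged to the expansions.  Every move is treated by an
    instance of this lemma. *)
Lemma expand_parallel wt wt' g g' G G' (d : B) s :
  parallel wt wt' s ->
  (forall q, subseq q s -> q <> s -> g (lefts q) = g' (rights q)) ->
  (forall q, subseq q s -> G (lefts q) =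
     G' (rights q) + (if q == s then d else 0)) ->
  expand wt g G (lefts s) = expand wt' g' G' (rights s) + d%:P.
Proof.
have [k] := ubnP (size s); elim: k s G G' d => // k IHk [|t s] G G' d /=.
  by move=> _ _ _ /(_ [::] isT) /=; rewrite !expand_nil -polyCD => ->.
rewrite ltnS => lek par gE GE.
have pars : parallel wt wt' s.
  by apply: parallel_sub par => x; rewrite !inE => ->; rewrite orbT.
have sub_s q : subseq q s -> subseq q (t :: s).
  by move=> qs; apply: subseq_trans qs (subseq_cons _ _).
have proper q : subseq q s -> q <> t :: s.
  by move=> /size_subseq + eq; rewrite eq /= ltnn.
case: t par gE GE sub_s proper => [[a a']|[b b']] par gE GE sub_s proper; last first.
  have [ib ib'] := parallel_inert par (mem_head _ _).
  rewrite lefts_block rights_block !expand_inert //.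
  apply: IHk => // q qs; first by move=> _; apply: gE (sub_s _ qs) (proper _ qs).
  by rewrite (GE (inr (b, b') :: q)) /= ?eqseq_cons ?eqxx.
have [ea wa] := parallel_wt par (mem_head _ _).
have keepE: expand wt g (fun q => G (a :: q)) (lefts s) =
    expand wt' g' (fun q => G' (a' :: q)) (rights s) + d%:P.
  apply: IHk => // q qs; first by move=> _; apply: gE (sub_s _ qs) (proper _ qs).
  by rewrite (GE (inl (a, a') :: q)) /= ?eqseq_cons ?eqxx.
case: (parallel_split par) => [[na na']|[u [r [defs na na']]]].
  by rewrite lefts_single rights_single !expand_keep //; right.
move: lek; rewrite defs size_cat /= => lek.
have subu : subseq u s by rewrite defs prefix_subseq.
have subr : subseq r s.
  by rewrite defs -cat1s catA suffix_subseq.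
have defl : lefts s = lefts u ++ mate a :: lefts r by rewrite defs lefts_cat.
have defr : rights s = rights u ++ mate a' :: rights r by rewrite defs rights_cat.
rewrite -defs.
rewrite lefts_single rights_single.
rewrite [in LHS]defl [in RHS]defr !expand_cut // -defl -defr keepE.
rewrite addrAC; congr (_ + _ + _); rewrite (eq_cut _ wa ea); congr (cut _ _ _ * _).
  rewrite (IHk u g g' 0) ?addr0 //; first by lia.
  - by apply: parallel_sub pars => x /(mem_subseq subu).
  - by move=> q qu _; apply: gE (sub_s _ _) (proper _ _); apply: subseq_trans qu _.
  - move=> q qu; rewrite if_same addr0.
    by apply: gE (sub_s _ _) (proper _ _); apply: subseq_trans qu _.
rewrite (IHk r G G' 0) ?addr0 //; first by lia.
- by apply: parallel_sub pars => x /(mem_subseq subr).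
- by move=> q qu _; apply: gE (sub_s _ _) (proper _ _); apply: subseq_trans qu _.
- move=> q qr; rewrite if_same addr0 GE; last exact/sub_s/(subseq_trans qr).
  case: eqP => [eqs|_]; last by rewrite addr0.
  by have := size_subseq qr; rewrite eqs defs /= size_cat /=; lia.
Qed.

Lemma expand_leading wt g G s :
  exists q, expand wt g G s = (G s)%:P + ('X%:A)%:P * q.
Proof.
have [k] := ubnP (size s); elim: k s G => // k IHk [|e s] G /=.
  by move=> _; exists 0; rewrite mulr0 addr0.
rewrite ltnS => lek.
have [q qE] := IHk s (fun q => G (e :: q)) lek.
have [es|es] := boolP (mate e \in s); last first.
  by exists q; rewrite expand_keep //; right.
have [s1 [s2 [defs es1]]] := split_first es.
rewrite -> defs in *; rewrite expand_cut // qE /cut.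
case: (wt _) => [b|]; last by exists q; rewrite mul0r addr0.
eexists; rewrite -addrA; congr (_ + _).
by rewrite -!mulrA -mulrDr.
Qed.

End Sim.

Lemma subseq_catE (T : eqType) (q a b : seq T) : subseq q (a ++ b) ->
  exists q1 q2, [/\ q = q1 ++ q2, subseq q1 a & subseq q2 b].
Proof.
case/subseqP=> m sm ->; rewrite size_cat in sm.
have st : size (take (size a) m) = size a by rewrite size_takel // sm leq_addr.
exists (mask (take (size a) m) a), (mask (drop (size a) m) b).
rewrite !mask_subseq -{1}(cat_take_drop (size a) m); split=> //.
by rewrite mask_cat.
Qed.

Lemma subseq_mapE (T U : eqType) (f : T -> U) (q : seq U) s :
  subseq q (map f s) -> exists2 q', q = map f q' & subseq q' s.
Proof.
case/subseqP=> m sm ->; exists (mask m s); rewrite ?map_mask //.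
exact: mask_subseq.
Qed.

Lemma subseq_consE (T : eqType) (t : T) q s : subseq q (t :: s) ->
  exists q', subseq q' s /\ (q = q' \/ q = t :: q').
Proof.
case: q => [|u q]; first by exists [::]; rewrite sub0seq; split=> //; left.
rewrite /=; case: eqP => [->|_] qs; first by exists q; split=> //; right.
by exists (u :: q); split=> //; left.
Qed.

Definition unchanged (w : seq endpoint) : seq item := [seq inl (x, x) | x <- w].

Lemma lefts_unchanged w : lefts (unchanged w) = w.
Proof. by elim: w => //= x w; rewrite lefts_single => ->. Qed.
Lemma rights_unchanged w : rights (unchanged w) = w.
Proof. by elim: w => //= x w; rewrite rights_single => ->. Qed.
Lemma mem_unchanged w a a' : (inl (a, a') \in unchanged w) = (a == a') && (a \in w).
Proof.
apply/mapP/andP => [[x xw [-> ->]]|[/eqP <- aw]]; first by rewrite eqxx.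
by exists a.
Qed.
Lemma block_notin_unchanged b w : (inr b \in unchanged w) = false.
Proof. by apply/mapP => -[]. Qed.
Lemma unchanged_inj : injective unchanged.
Proof. by apply: inj_map => x y []. Qed.

Definition itemsE := (lefts_cat, rights_cat, lefts_block, rights_block,
  lefts_unchanged, rights_unchanged, lefts_single, rights_single).

(** An arrow between two different components is discarded.  Since [expand] leaves its
    endpoints in the words, the values have to ignore endpoints without a mate. *)
Definition droppable (T : Type) (g : seq endpoint -> T) : Prop :=
  forall x b y, {in b, forall e, mate e \notin x ++ b ++ y} ->
  g (x ++ b ++ y) = g (x ++ y).

Section Replace.
Variable B : comAlgType {poly rat}.
Implicit Types (wt : nat -> option bool) (g G : seq endpoint -> B).

Lemma expand_congr wt wt' g g' G G' d s :
  {in s, forall x, wt x.1 = wt' x.1} ->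
  (forall q, subseq q s -> q <> s -> g q = g' q) ->
  (forall q, subseq q s -> G q = G' q + (if q == s then d else 0)) ->
  expand wt g G s = expand wt' g' G' s + d%:P.
Proof.
move=> ws gE GE.
have := @expand_parallel _ wt wt' g g' G G' d (unchanged s).
rewrite lefts_unchanged rights_unchanged; apply.
- split=> [a a'|a a' c c'|b b'|a a' b b'].
  + by rewrite mem_unchanged => /andP[/eqP <- /ws].
  + by rewrite !mem_unchanged => /andP[/eqP <- _] /andP[/eqP <- _].
  + by rewrite block_notin_unchanged.
  + by rewrite block_notin_unchanged.
- move=> _ /subseq_mapE[q -> qs] nqs.
  rewrite -/(unchanged q) lefts_unchanged rights_unchanged gE // => eqs.
  by apply: nqs; rewrite eqs.
- move=> _ /subseq_mapE[q -> qs].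
  rewrite -/(unchanged q) lefts_unchanged rights_unchanged GE //.
  by rewrite (inj_eq unchanged_inj).
Qed.

Lemma expand_replace wt wt' g G G' d x y t t' :
  {in x ++ y, forall a, wt a.1 = wt' a.1} ->
  inert wt t (x ++ t ++ y) -> inert wt' t' (x ++ t' ++ y) ->
  {in x ++ y, forall a, mate a \notin t ++ t'} ->
  (forall x' y', subseq x' x -> subseq y' y -> g (x' ++ t ++ y') = g (x' ++ t' ++ y')) ->
  (forall x' y', subseq x' x -> subseq y' y -> G (x' ++ y') = G' (x' ++ y')) ->
  (forall x' y', subseq x' x -> subseq y' y -> (x', y') <> (x, y) ->
    G (x' ++ t ++ y') = G' (x' ++ t' ++ y')) ->
  G (x ++ t ++ y) = G' (x ++ t' ++ y) + d ->
  expand wt g G (x ++ t ++ y) = expand wt' g G' (x ++ t' ++ y) + d%:P.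
Proof.
move=> wxy it it' nt gE G0 G1 Gd.
set s := unchanged x ++ inr (t, t') :: unchanged y.
have ls : lefts s = x ++ t ++ y by rewrite !itemsE.
have rs : rights s = x ++ t' ++ y by rewrite !itemsE.
have mem1 a a' : inl (a, a') \in s -> a = a' /\ a \in x ++ y.
  rewrite !(mem_cat, inE) !mem_unchanged orFb.
  by case/orP=> /andP[/eqP <- ->]; rewrite ?orbT.
have mem2 b b' : inr (b, b') \in s -> (b, b') = (t, t').
  rewrite mem_cat inE !block_notin_unchanged /= orbF => /eqP[-> ->] //.
have subE q : subseq q s -> exists x' y', [/\ subseq x' x, subseq y' y &
    q = unchanged x' ++ unchanged y' \/
    q = unchanged x' ++ inr (t, t') :: unchanged y'].
  case/subseq_catE=> _ [q2 [-> /subseq_mapE[x' -> sx]]].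
  case/subseq_consE=> _ [/subseq_mapE[y' -> sy] q2E].
  by exists x', y'; split=> //; case: q2E => ->; [left|right].
have := @expand_parallel _ wt wt' g g G G' d s; rewrite ls rs; apply.
- split=> [a a'|a a' c c'|b b'|a a' b b'].
  + by case/mem1=> <- /wxy.
  + by case/mem1=> <- _ /mem1[<- _].
  + by case/mem2=> -> ->; rewrite ls rs.
  + case/mem1=> <- /nt + /mem2[-> ->].
    by rewrite mem_cat negb_or => /andP[].
- by move=> _ /subE[x' [y' [sx sy [] ->]]] _; rewrite !itemsE // gE.
- move=> q qs; case: eqP => [->|nqs]; first by rewrite ls rs.
  case: (subE _ qs) nqs => [x' [y' [sx sy [] ->]]] nqs.
    by rewrite !itemsE G0 // addr0.
  rewrite !itemsE G1 ?addr0 // => -[ex ey]; apply: nqs.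
  by rewrite ex ey.
Qed.

Lemma expand_replace2 wt g G G' d x y z t t' u u' :
  inert wt (t ++ u) (x ++ t ++ y ++ u ++ z) ->
  inert wt (t' ++ u') (x ++ t' ++ y ++ u' ++ z) ->
  {in x ++ y ++ z, forall a, mate a \notin t ++ t' ++ u ++ u'} ->
  (forall (b c : bool) x' y' z', subseq x' x -> subseq y' y -> subseq z' z ->
    g (x' ++ (if b then t else [::]) ++ y' ++ (if c then u else [::]) ++ z') =
    g (x' ++ (if b then t' else [::]) ++ y' ++ (if c then u' else [::]) ++ z')) ->
  (forall (b c : bool) x' y' z', subseq x' x -> subseq y' y -> subseq z' z ->
    (b, c, x', y', z') <> (true, true, x, y, z) ->
    G (x' ++ (if b then t else [::]) ++ y' ++ (if c then u else [::]) ++ z') =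
    G' (x' ++ (if b then t' else [::]) ++ y' ++ (if c then u' else [::]) ++ z')) ->
  G (x ++ t ++ y ++ u ++ z) = G' (x ++ t' ++ y ++ u' ++ z) + d ->
  expand wt g G (x ++ t ++ y ++ u ++ z) =
  expand wt g G' (x ++ t' ++ y ++ u' ++ z) + d%:P.
Proof.
move=> it it' nt gE G1 Gd.
set s := unchanged x ++ inr (t, t') :: unchanged y ++ inr (u, u') :: unchanged z.
have ls : lefts s = x ++ t ++ y ++ u ++ z by rewrite !itemsE.
have rs : rights s = x ++ t' ++ y ++ u' ++ z by rewrite !itemsE.
have mem1 a a' : inl (a, a') \in s -> a = a' /\ a \in x ++ y ++ z.
  rewrite !(mem_cat, inE) !mem_unchanged !orFb.
  by case/or3P=> /andP[/eqP <- ->]; rewrite ?orbT.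
have mem2 b b' : inr (b, b') \in s -> (b, b') = (t, t') \/ (b, b') = (u, u').
  rewrite !(mem_cat, inE) !block_notin_unchanged /= orbF.
  by case/orP=> /eqP[-> ->]; [left|right].
have subE q : subseq q s -> exists (b c : bool) x' y' z',
    [/\ subseq x' x, subseq y' y, subseq z' z &
    q = unchanged x' ++ (if b then [:: inr (t, t')] else [::]) ++
        unchanged y' ++ (if c then [:: inr (u, u')] else [::]) ++ unchanged z'].
  case/subseq_catE=> _ [q2 [-> /subseq_mapE[x' -> sx]]].
  case/subseq_consE=> q3 [/subseq_catE[_ [q4 [-> /subseq_mapE[y' -> sy]]]]].
  case/subseq_consE=> _ [/subseq_mapE[z' -> sz]] [] -> [] ->.
  - by exists false, false, x', y', z'.
  - by exists true, false, x', y', z'.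
  - by exists false, true, x', y', z'.
  - by exists true, true, x', y', z'.
have bE (b : bool) v v' : lefts (if b then [:: inr (v, v')] else [::]) = (if b then v else [::]).
  by case: b; rewrite ?lefts_block ?cats0.
have bE' (b : bool) v v' : rights (if b then [:: inr (v, v')] else [::]) = (if b then v' else [::]).
  by case: b; rewrite ?rights_block ?cats0.
have := @expand_parallel _ wt wt g g G G' d s; rewrite ls rs; apply.
- split=> [a a'|a a' c c'|b b'|a a' b b'].
  + by case/mem1=> <-.
  + by case/mem1=> <- _ /mem1[<- _].
  + by rewrite ls rs => /mem2[] [-> ->]; split=> e eb; [apply: it|apply: it'|apply: it|apply: it'];
      rewrite mem_cat eb ?orbT.
  + case/mem1=> <- /nt + /mem2[] [-> ->];
    by rewrite !mem_cat !negb_or => /and4P[].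
- by move=> _ /subE[b [c [x' [y' [z' [sx sy sz ->]]]]]] _; rewrite !itemsE !bE !bE' gE.
- move=> q qs; case: eqP => [->|nqs]; first by rewrite ls rs.
  case: (subE _ qs) nqs => [b [c [x' [y' [z' [sx sy sz ->]]]]]] nqs.
  rewrite !itemsE !bE !bE' G1 ?addr0 // => -[eb ec ex ey ez]; apply: nqs.
  by rewrite eb ec ex ey ez.
Qed.

Lemma expand_drop wt g G G' x b y :
  droppable g -> {in b, forall e, mate e \notin x ++ b ++ y} ->
  (forall x' y', subseq x' x -> subseq y' y -> G (x' ++ y') = G' (x' ++ y')) ->
  (forall x' y', subseq x' x -> subseq y' y -> G (x' ++ b ++ y') = G' (x' ++ y')) ->
  expand wt g G (x ++ b ++ y) = expand wt g G' (x ++ y).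
Proof.
move=> gd nb G0 G1.
have sub_nb x' y' : subseq x' x -> subseq y' y ->
    {in b, forall e, mate e \notin x' ++ b ++ y'}.
  move=> sx sy e /nb; apply: contraNN; apply: mem_subseq.
  by rewrite !cat_subseq.
rewrite -[y in RHS]cat0s -[RHS]addr0; apply: (@expand_replace wt wt) => //.
- by move=> e /nb; right.
- move=> a axy; rewrite cats0; apply/negP => /nb; rewrite mateK.
  by move: axy; rewrite !mem_cat => /orP[->|->]; rewrite ?orbT.
- by move=> x' y' sx sy; apply/gd/sub_nb.
- by move=> x' y' sx sy _; rewrite G1.
- by rewrite addr0 G1.
Qed.

Lemma expand_drop_id wt g x b y : droppable g ->
  {in b, forall e, mate e \notin x ++ b ++ y} ->
  expand wt g g (x ++ b ++ y) = expand wt g g (x ++ y).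
Proof.
move=> gd nb; apply: expand_drop => // x' y' sx sy; apply: gd => e /nb.
by apply: contraNN; apply: mem_subseq; rewrite !cat_subseq.
Qed.

End Replace.

Section Relabel.
Variable B : comAlgType {poly rat}.
Implicit Types (wt : nat -> option bool) (g G : seq endpoint -> B).

Definition relabel (f : nat -> nat) (x : endpoint) : endpoint := (f x.1, x.2).

Lemma expand_relabel f wt wt' g d s :
  {in s &, forall x y, f x.1 = f y.1 -> x.1 = y.1} ->
  {in s, forall x, wt' (f x.1) = wt x.1} ->
  (forall q, subseq q s -> q <> s -> g q = g (map (relabel f) q)) ->
  g s = g (map (relabel f) s) + d ->
  expand wt g g s = expand wt' g g (map (relabel f) s) + d%:P.
Proof.
move=> fI fw gE gd; pose it x : item := inl (x, relabel f x).
have itI : injective it by move=> x y [].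
have ls w : lefts (map it w) = w.
  by elim: w => //= x w; rewrite lefts_single => ->.
have rs w : rights (map it w) = map (relabel f) w.
  by elim: w => //= x w; rewrite rights_single => ->.
have memE a a' : inl (a, a') \in map it s -> a' = relabel f a /\ a \in s.
  by case/mapP=> x xs [-> ->].
have := @expand_parallel _ wt wt' g g g g d (map it s); rewrite ls rs; apply.
- split=> [a a'|a a' c c'|b b'|a a' b b'].
  + by case/memE=> -> /fw.
  + case/memE=> -> ais /memE[-> cis]; rewrite /mate /relabel -!pair_eqE /=.
    congr (_ && _); apply/eqP/eqP => [->//|]; exact: fI.
  + by case/mapP.
  + by move=> _ /mapP[].
- move=> _ /subseq_mapE[q -> qs] nqs; rewrite ls rs gE // => eqs.
  by apply: nqs; rewrite eqs.
- move=> _ /subseq_mapE[q -> qs]; rewrite ls rs (inj_eq (inj_map itI)).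
  by case: eqP => [->|nqs]; rewrite ?gd // addr0 gE.
Qed.

End Relabel.

(** * Base points, kinks and the skein relation *)

Section Invariance.
Variable B : comAlgType {poly rat}.
Implicit Types (wt : nat -> option bool) (g G : seq endpoint -> B).
Implicit Types (e : endpoint) (s x y z : seq endpoint).

(** Averaging over the label of the last component, the one with the base point. *)
Definition state_sum wt g s : B := mean (expand wt g g s).

Definition uncut wt (e : endpoint) : nat -> option bool :=
  fun i => if i == e.1 then None else wt i.

(** Either of the two components joined by a cut may be taken as the root. *)
Lemma cut_mate wt e (p q : {poly B}) :
  mean (cut wt e p * q) = mean (p * cut wt (mate e) q).
Proof.
rewrite /cut /=; case: (wt _) => [b|]; last by rewrite mulr0 mul0r.
have E (x y z : {poly B}) : x * (y * z) = y * (x * z) by ring.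
have E' (x y z : {poly B}) : x * y * z = x * (y * z) by ring.
have cE (c : B) (x y : {poly B}) : mean (c%:P * x * y) = c * mean (x * y).
  by rewrite E' meanCM.
have Ec (c : B) (x y : {poly B}) : mean (x * (c%:P * y)) = c * mean (x * y).
  by rewrite E meanCM.
case: b; rewrite /= ?expr0 ?expr1 ?mulr1 ?mulrN1 -?polyCN cE Ec; congr (_ * _);
  by case: (e.2); rewrite /= mean_above || rewrite /= [p * _]mulrC mean_above mulrC.
Qed.

(** Only the arrows with both endpoints in the word can be cut. *)
Lemma eq_expand_wt wt wt' g G s :
  (forall x : endpoint, x \in s -> mate x \in s -> wt x.1 = wt' x.1) ->
  expand wt g G s = expand wt' g G s.
Proof.
have [k] := ubnP (size s); elim: k s G => // k IHk [|e s] G //=.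
rewrite ltnS => lek ws.
have ws' : (forall x : endpoint, x \in s -> mate x \in s -> wt x.1 = wt' x.1).
  by move=> x xs mxs; apply: ws; rewrite inE ?xs ?mxs orbT.
have [es|es] := boolP (mate e \in s); last by rewrite !expand_keep ?IHk //; right.
have we : wt e.1 = wt' e.1 by apply: ws; rewrite ?mem_head // inE es orbT.
have [s1 [s2 [defs es1]]] := split_first es; rewrite -> defs in *.
move: lek; rewrite size_cat /= => lek.
have lek' : (size (s1 ++ mate e :: s2) < k)%N by rewrite size_cat.
have [l1 l2] : (size s1 < k)%N /\ (size s2 < k)%N by split; lia.
rewrite !expand_cut // (eq_cut _ we) // !IHk //.
- by move=> x xs mxs; apply: ws'; rewrite mem_cat inE ?xs ?mxs ?orbT.
- by move=> x xs mxs; apply: ws'; rewrite mem_cat inE ?xs ?mxs ?orbT.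
Qed.

Lemma expand_uncut wt g G e s : (e \notin s) || (mate e \notin s) ->
  expand (uncut wt e) g G s = expand wt g G s.
Proof.
move=> es; apply: eq_expand_wt => x xs mxs; rewrite /uncut; case: eqP => // ex.
suff: x = e \/ x = mate e.
  by case: (orP es) => /negP nes [] eqx; case: nes; rewrite eqx ?mateK // in xs mxs.
by case: x e ex {es xs mxs} => i [] [j []] /= ->; [left|right|right|left].
Qed.

(** Separates the terms in which the first arrow is cut. *)
Lemma state_sum_cut wt g e s1 s2 : uniq (e :: s1 ++ mate e :: s2) ->
  state_sum wt g (e :: s1 ++ mate e :: s2) =
  state_sum (uncut wt e) g (e :: s1 ++ mate e :: s2) +
  mean (cut wt e (expand wt g g s1) * expand wt g g s2).
Proof.
rewrite /= => /andP[es us].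
have es1 : mate e \notin s1.
  by move: us; rewrite cat_uniq /= negb_or => /and3P[_ /andP[]].
rewrite /state_sum !expand_cut // [cut (uncut _ _) _ _]cut_None /uncut ?eqxx //.
rewrite mul0r addr0 meanD; congr (mean _ + _).
by rewrite expand_uncut // es.
Qed.

(** The state sum does not depend on the base point, up to the leading terms.  If the
    arrow of [e] is cut, the base point passes to the other component, and [cut_mate]
    applies. *)
Lemma state_sum_rcons wt g e s : uniq (e :: s) ->
  (forall q, subseq q s -> q <> s -> g (e :: q) = g (rcons q e)) ->
  state_sum wt g (e :: s) = state_sum wt g (rcons s e) + (g (e :: s) - g (rcons s e)).
Proof.
move=> ues gE.
have kE : expand wt g (fun q => g (e :: q)) s =
    expand wt g (fun q => g (rcons q e)) s + (g (e :: s) - g (rcons s e))%:P.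
  apply: expand_congr => // q qs; case: eqP => [->|nqs]; first by rewrite addrC subrK.
  by rewrite addr0 gE.
have [es|es] := boolP (mate e \in s); last first.
  rewrite /state_sum expand_keep; last by right.
  by rewrite expand_rcons_inert // kE meanD meanC.
have [s1 [s2 [defs es1]]] := split_first es; rewrite -> defs in *.
rewrite /state_sum expand_cut // kE rcons_cat /= expand_rcons_cut; last first.
  by rewrite -rcons_cons -rcons_cat rcons_uniq.
by rewrite !meanD meanC cut_mate addrAC.
Qed.

(** Cutting the kink splits off an empty word. *)
Lemma state_sum_kink wt g e s : uniq (e :: mate e :: s) -> g [::] = 0 ->
  (forall q, subseq q s -> q <> s -> g (e :: mate e :: q) = g q) ->
  state_sum wt g (e :: mate e :: s) = state_sum wt g s + (g (e :: mate e :: s) - g s).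
Proof.
rewrite /= inE negb_or => /and3P[/andP[_ es] e's us] g0 gE.
have kE : expand wt g (fun q => g (e :: mate e :: q)) s =
    expand wt g g s + (g (e :: mate e :: s) - g s)%:P.
  apply: expand_congr => // q qs; case: eqP => [->|nqs]; first by rewrite addrC subrK.
  by rewrite addr0 gE.
have cE := @expand_cut _ wt g g e [::] s isT.
rewrite /state_sum cE expand_nil g0 cut0 mul0r addr0 expand_keep; last first.
  by right; rewrite mateK.
by rewrite kE meanD meanC.
Qed.

(** The requirements of a cut for the two signs of the arrow are complementary, so their
    sum leaves the labels on the two sides independent. *)
Lemma state_sum_skein wt wt' g e s1 s2 : uniq (e :: s1 ++ mate e :: s2) ->
  wt e.1 = Some true -> wt' e.1 = Some false ->
  (forall i, i != e.1 -> wt i = wt' i) ->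
  state_sum wt g (e :: s1 ++ mate e :: s2) - state_sum wt' g (e :: s1 ++ mate e :: s2) =
  'X *: (state_sum wt g s1 * state_sum wt g s2).
Proof.
move=> ues we we' wne.
have eq_wt s : (e \notin s) || (mate e \notin s) ->
    forall G, expand wt' g G s = expand wt g G s.
  move=> es G; rewrite -(expand_uncut wt' _ _ es) -(expand_uncut wt _ _ es).
  apply: eq_expand_wt => x xs mxs; rewrite /uncut; case: eqP => // /eqP ne.
  by rewrite wne.
move: (ues); rewrite /= mem_cat inE cat_uniq /= !negb_or.
case/and3P=> /and3P[e1 _ e2] _ /and3P[/andP[e'1 _] e'2 _].
rewrite (state_sum_cut wt) // (state_sum_cut wt') // opprD addrACA.
have -> : state_sum (uncut wt' e) g (e :: s1 ++ mate e :: s2) =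
          state_sum (uncut wt e) g (e :: s1 ++ mate e :: s2).
  rewrite /state_sum; congr mean; apply: eq_expand_wt => x _ _; rewrite /uncut.
  by case: eqP => // /eqP /wne ->.
rewrite subrr add0r !eq_wt ?e1 ?e2 // /cut we we'.
have E (p : {poly B}) : integ_above p + integ_below p = (mean p)%:P by rewrite subrK.
set p1 := expand _ _ _ s1; set p2 := expand _ _ _ s2.
rewrite -meanN -meanD -mulNr -mulrDl.
set c : {poly B} := ('X%:A)%:P.
have -> : c * (-1) ^+ (~~ true) * (if true == e.2 then integ_above p1 else integ_below p1) -
  c * (-1) ^+ (~~ false) * (if false == e.2 then integ_above p1 else integ_below p1)
  = c * (mean p1)%:P.
  by rewrite -E; case: (e.2); rewrite /= expr0 expr1; ring.
by rewrite -polyCM meanCM mulr_algl scalerAl.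
Qed.

End Invariance.

(** * Moves (b) and (c) on words *)

Ltac perm_by_count :=
  apply/permP=> ?; rewrite -?cats1 -?cats1 -?cats1 ?count_cat /= ?count_cat /= ?count_cat /=; ring.

Ltac uniq_from H := match type of H with is_true (uniq ?w) =>
  match goal with |- is_true (uniq ?v) =>
  (have -> : uniq v = uniq w by (apply: perm_uniq; perm_by_count)); exact: H end end.

Lemma perm_eq2 (T : eqType) (a b : T) t : perm_eq t [:: a; b] ->
  t = [:: a; b] \/ t = [:: b; a].
Proof.
case: t => [|c [|c' [|c'' t]]] p; have := perm_size p => //= _.
have := perm_mem p c; rewrite !inE eqxx => /esym/orP[] /eqP ec; rewrite -ec in p *.
  by left; move: p; rewrite perm_cons => /perm_consP[i [u [+ ]]]; case: i u => [|i] [|? ?] //= [->].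
right; have p' : perm_eq [:: c; c'] [:: c; a].
  by apply: perm_trans p _; perm_by_count.
by move: p'; rewrite perm_cons => /perm_consP[i [u [+ ]]]; case: i u => [|i] [|? ?] //= [->].
Qed.

Lemma notin_subseq (T : eqType) (s' s : seq T) a :
  subseq s' s -> a \notin s -> a \notin s'.
Proof. by move=> /mem_subseq ss; apply: contraNN => /ss. Qed.

Section Moves.
Variable B : comAlgType {poly rat}.
Implicit Types (wt : nat -> option bool) (g G : seq endpoint -> B).
Implicit Types (e f : endpoint) (s x y z t : seq endpoint).

Definition rot_inv g := forall e s, g (e :: s) = g (rcons s e).
Definition kink_inv g := forall e s, uniq (e :: mate e :: s) ->
  g (e :: mate e :: s) = g s.
(** Move (b): the two arrows start with endpoints of different kinds, in either order. *)
Definition slide_inv g := forall e f x t y, e.2 != f.2 ->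
  perm_eq t [:: mate e; mate f] -> uniq (e :: f :: x ++ t ++ y) ->
  g (e :: f :: x ++ t ++ y) = g (x ++ y).

Lemma expand_ext wt g G G' s : (forall q, subseq q s -> G q = G' q) ->
  expand wt g G s = expand wt g G' s.
Proof.
move=> GE; rewrite -[RHS]addr0; apply: (@expand_congr _ _ _ _ _ _ _ 0) => // q qs.
by rewrite if_same addr0 GE.
Qed.

Lemma state_sum_catC wt g s t : rot_inv g -> uniq (s ++ t) ->
  state_sum wt g (s ++ t) = state_sum wt g (t ++ s).
Proof.
move=> gr; elim: s t => [|e s IHs] t ust; first by rewrite cats0.
rewrite -cat_rcons -IHs; last by uniq_from ust.
rewrite -rcons_cat state_sum_rcons //.
by rewrite gr subrr addr0.
Qed.

Section Fixed.
Variables (wt : nat -> option bool) (g : seq endpoint -> B).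
Hypotheses (g0 : g [::] = 0) (gdrop : droppable g) (grot : rot_inv g).
Hypothesis gkink : kink_inv g.
Local Notation Y := (expand wt g g).

(** The kink is split by the base point. *)
Lemma rot_kink e s : uniq (e :: mate e :: s) -> g (e :: rcons s (mate e)) = g s.
Proof.
move=> us; have -> : g (e :: rcons s (mate e)) = g (mate e :: mate (mate e) :: s).
  by rewrite [RHS]grot mateK.
by apply: gkink; rewrite mateK; uniq_from us.
Qed.

Lemma expand_wrap e x : uniq (e :: mate e :: x) ->
  Y (e :: rcons x (mate e)) = Y x.
Proof.
move=> us; rewrite -cats1 expand_cut; last by move: us => /= /and3P[].
rewrite expand_nil g0 mulr0 addr0 cats1 expand_rcons_inert; last first.
  by rewrite mateK; move: us; rewrite /= inE negb_or => /andP[/andP[]].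
apply: expand_ext => q qs; apply: rot_kink; apply: subseq_uniq us.
by rewrite /= !eqxx.
Qed.

(** If the arrows are unlinked, the component split off by cutting one of them carries
    the other one as a kink, and cutting both yields an empty word.  If they are linked,
    the other one is discarded.  In both cases the same two components remain, and the
    coefficients of the two cuts cancel.  If none of the two is cut, the block [t]
    either stays on the component of [e] and [f], where move (b) removes both arrows, or
    is cut away from them, and both arrows are discarded. *)
Lemma expand_slide e f x t y : e.2 != f.2 ->
  perm_eq t [:: mate e; mate f] -> uniq (e :: f :: x ++ t ++ y) ->
  (forall p : {poly B}, cut wt e p + cut wt f p = 0) ->
  (forall x' y', subseq x' x -> subseq y' y -> (x', y') <> (x, y) ->
     g (e :: f :: x' ++ t ++ y') = g (x' ++ y')) ->
  Y (e :: f :: x ++ t ++ y) =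
  Y (x ++ y) + (g (e :: f :: x ++ t ++ y) - g (x ++ y))%:P.
Proof.
move=> nef pt us cutE gE.
have u2 : uniq (e :: f :: mate e :: mate f :: x ++ y).
  suff -> : uniq (e :: f :: mate e :: mate f :: x ++ y) = uniq (e :: f :: x ++ t ++ y) by [].
  apply: perm_uniq; move/permP: pt => pt; apply/permP=> p.
  by rewrite /= !count_cat pt /=; ring.
have ut : t =i [:: mate e; mate f] by exact: perm_mem.
move: (u2); rewrite /= !inE !mem_cat !negb_or.
case/and5P=> /and5P[ef ee ef' ex ey] /and4P[fe ff fx fy] /and3P[mef mex mey] /andP[mfx mfy] uxy.
have keepE : expand wt g (fun q => g (e :: f :: q)) (x ++ t ++ y) =
    Y (x ++ y) + (g (e :: f :: x ++ t ++ y) - g (x ++ y))%:P.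
  have nmem (l : endpoint) : l \in t -> mate l \notin x ++ t ++ y.
    rewrite ut !mem_cat !ut !inE => /orP[] /eqP ->;
    rewrite mateK !negb_or ?ex ?ey ?fx ?fy ?ee ?ef' ?fe ?ff //.
  rewrite -[y in Y (x ++ y)]cat0s; apply: expand_replace => //.
  - by move=> z zt; right; apply: nmem.
  - move=> a axy; rewrite cats0 ut !inE negb_or !(inj_eq (inv_inj mateK)).
    by apply/andP; split; apply/eqP => ea; move: axy; rewrite ea mem_cat
      ?(negbTE ex) ?(negbTE ey) ?(negbTE fx) ?(negbTE fy).
  - move=> x' y' sx sy; apply: gdrop => l /nmem; apply: contraNN; apply: mem_subseq.
    by rewrite !cat_subseq.
  - move=> x' y' sx sy; rewrite -[e :: _]/([::] ++ [:: e; f] ++ (x' ++ y')).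
    apply: gdrop => l; rewrite !inE => /orP[] /eqP ->;
    rewrite !(mem_cat, inE) !negb_or ?mate_neq /= ?(notin_subseq sx) ?(notin_subseq sy) //.
      by rewrite eq_sym fe.
    by rewrite eq_sym ef'.
  - by rewrite addrC subrK.
have Yfx : Y (f :: x) = Y x.
  rewrite -[f :: x]/([::] ++ [:: f] ++ x); apply: expand_drop_id => // l.
  by rewrite !inE => /eqP ->; rewrite mate_neq mfx.
have Yfy : Y (mate f :: y) = Y y.
  rewrite -[_ :: y]/([::] ++ [:: mate f] ++ y); apply: expand_drop_id => // l.
  by rewrite !inE => /eqP ->; rewrite mateK negb_or fy eq_sym mate_neq.
have Yxe : Y (rcons x (mate e)) = Y x.
  rewrite -cats1 -[x ++ [:: _]]/(x ++ [:: mate e] ++ [::]) expand_drop_id ?cats0 //.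
  by move=> l; rewrite inE => /eqP ->; rewrite mateK mem_cat inE negb_or ex ee.
(* The two orders of [t]: first the arrows are linked, then unlinked. *)
case: (perm_eq2 pt) keepE => -> keepE.
  have -> : [:: e, f & x ++ [:: mate e; mate f] ++ y]
    = e :: (f :: x) ++ mate e :: mate f :: y by [].
  rewrite expand_cut ?Yfx ?Yfy; last by rewrite inE negb_or mate_eq ef' mex.
  have -> : (f :: x) ++ mate e :: mate f :: y = f :: rcons x (mate e) ++ mate f :: y.
    by rewrite cat_rcons.
  rewrite expand_cut; last by rewrite mem_rcons inE negb_or eq_sym mef mfx.
  rewrite cat_rcons keepE Yxe.
  rewrite [expand _ _ (fun q => g (e :: q)) y](@expand_ext _ _ _ g); last first.
    move=> q qy; rewrite -[_ :: q]/([::] ++ [:: e] ++ q); apply: gdrop => l.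
    by rewrite !inE => /eqP ->; rewrite mate_neq (notin_subseq qy).
  by rewrite -!addrA -mulrDl [cut wt f _ + _]addrC cutE mul0r addr0.
have -> : [:: e, f & x ++ [:: mate f; mate e] ++ y]
    = e :: (f :: rcons x (mate f)) ++ mate e :: y by rewrite /= cat_rcons.
rewrite expand_cut; last first.
  by rewrite !(inE, mem_rcons) !negb_or mate_eq ef' mef mex.
rewrite expand_wrap; last first.
  have: subseq [:: f, mate f & x] [:: e, f, mate e, mate f & x ++ y].
    rewrite -[[:: e, _, _, _ & _]]/([:: e; f; mate e; mate f] ++ x ++ y).
    rewrite -[[:: f, mate f & x]]/([:: f; mate f] ++ x) catA -[[:: f; mate f] ++ x]cats0.
    apply: cat_subseq (sub0seq _); apply: cat_subseq => //.
    by apply/subseqP; exists [:: false; true; false; true].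
  by move=> /subseq_uniq; apply.
have -> : (f :: rcons x (mate f)) ++ mate e :: y = f :: x ++ mate f :: mate e :: y.
  by rewrite /= cat_rcons.
rewrite expand_cut //.
have keepE' : expand wt g (fun q => g (e :: f :: q)) (x ++ mate f :: mate e :: y) =
  Y (x ++ y) + (g (e :: f :: x ++ mate f :: mate e :: y) - g (x ++ y))%:P by [].
rewrite keepE' expand_keep; last by right; rewrite mateK.
rewrite [expand _ _ (fun q => g (e :: mate e :: q)) y](@expand_ext _ _ _ g); last first.
  move=> q qy; apply: gkink; apply: (subseq_uniq _ u2).
  rewrite -[[:: e, _, _, _ & _]]/([:: e; f; mate e; mate f] ++ x ++ y).
  rewrite -[[:: e, mate e & q]]/([:: e; mate e] ++ q).
  apply: cat_subseq; last exact: subseq_trans qy (suffix_subseq _ _).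
  by apply/subseqP; exists [:: true; false; true; false].
by rewrite -!addrA -mulrDl [cut wt f _ + _]addrC cutE mul0r addr0.
Qed.

Hypothesis gslide : slide_inv g.

(** Cutting the arrow of [e] splits off [x] and turns the arrow of [f] into a kink around
    [y], and vice versa; cutting both leaves an empty component.  If none is cut, the two
    arrows form a pair that move (b) removes. *)
Lemma expand_chain e f x y : e.2 = f.2 ->
  uniq (e :: x ++ mate e :: f :: rcons y (mate f)) ->
  Y (e :: x ++ mate e :: f :: rcons y (mate f)) =
  Y (x ++ y) + cut wt e (Y x) * Y y + cut wt f (Y y) * Y x.
Proof.
move=> ef2 us.
have u2 : uniq (e :: f :: mate e :: mate f :: x ++ y) by uniq_from us.
move: (u2); rewrite /= !inE !mem_cat !negb_or.
case/and5P=> /and5P[ef ee ef' ex ey] /and4P[fe ff fx fy] /and3P[mef mex mey] /andP[mfx mfy] uxy.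
rewrite expand_cut // expand_wrap; last first.
  have : uniq ((f :: mate f :: y) ++ e :: mate e :: x) by uniq_from us.
  by rewrite cat_uniq => /and3P[].
rewrite addrAC; congr (_ + _).
have -> : x ++ mate e :: f :: rcons y (mate f) =
    rcons x (mate e) ++ mate (mate f) :: rcons y (mate f) by rewrite mateK cat_rcons.
rewrite expand_rcons_cut; last first.
  rewrite mateK.
  have : uniq (e :: (rcons x (mate e) ++ f :: rcons y (mate f))) by uniq_from us.
  by case/andP.
rewrite mateK expand_rcons_inert ?mateK // [_ * cut _ _ _]mulrC; congr (_ + _ * _).
  rewrite cat_rcons -[_ :: _ :: y]/([:: mate e; f] ++ y).
  rewrite -[y in Y (x ++ y)]cat0s -[RHS]addr0.
  have gE x' y' : subseq x' x -> subseq y' y ->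
      g (e :: rcons (x' ++ [:: mate e; f] ++ y') (mate f)) = g (x' ++ y').
    move=> sx sy; rewrite -rcons_cons -grot gslide //.
    + by rewrite /= ef2; case: (f.2).
    + by rewrite mateK; perm_by_count.
    + have sub : subseq ([:: mate f; e; mate e; f] ++ x' ++ y') ([:: mate f; e; mate e; f] ++ x ++ y).
        by rewrite !cat_subseq.
      have := subseq_uniq sub; have -> : uniq ([:: mate f; e; mate e; f] ++ x ++ y) by uniq_from us.
      by move=> /(_ isT) u3; uniq_from u3.
  have nmem (l : endpoint) : l \in [:: mate e; f] -> mate l \notin x ++ [:: mate e; f] ++ y.
    by rewrite !(mem_cat, inE) => /orP[] /eqP ->;
      rewrite ?mateK !negb_or ?ex ?ey ?ef ?ee ?mfx ?mfy //= ?mate_neq ?andbT // eq_sym mef.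
  apply: (@expand_replace _ _ _ _ _ _ 0) => //.
  - by move=> l /nmem; right.
  - move=> l lxy; rewrite cats0 !inE negb_or (inj_eq (inv_inj mateK)) mate_eq.
    by apply/andP; split; apply/eqP => el; move: lxy; rewrite el mem_cat
      ?(negbTE ex) ?(negbTE ey) ?(negbTE mfx) ?(negbTE mfy).
  - move=> x' y' sx sy; apply: gdrop => l /nmem; apply: contraNN; apply: mem_subseq.
    by rewrite !cat_subseq.
  - move=> x' y' sx sy; rewrite -rcons_cons -grot.
    rewrite -[_ :: _]/([::] ++ [:: mate f; e] ++ (x' ++ y')).
    apply: gdrop => l; rewrite !inE => /orP[] /eqP ->;
    rewrite !(mem_cat, inE) !negb_or ?mateK ?mate_neq /= ?(notin_subseq sx) ?(notin_subseq sy) //.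
      by rewrite ff eq_sym ef.
    by rewrite mef.
  - by move=> x' y' sx sy _; rewrite gE.
  - by rewrite addr0 gE.
apply: expand_ext => q qs; apply: rot_kink.
have sub : subseq ([:: e; mate e] ++ q ++ [::]) ([:: e; mate e] ++ x ++ f :: rcons y (mate f)).
  by rewrite cat_subseq // cat_subseq // sub0seq.
have := subseq_uniq sub; rewrite cats0; apply; uniq_from us.
all: match goal with |- ?G => idtac G end. Qed.

End Fixed.
End Moves.

Lemma droppable_clean (T : Type) (g : seq endpoint -> T) w : droppable g ->
  g w = g [seq e <- w | mate e \in w].
Proof.
move=> gd; set p := fun e => _.
suff E w1 w2 : w = w1 ++ w2 -> g w = g (filter p w1 ++ w2).
  by rewrite (E w [::]) ?cats0.
elim/last_ind: w1 w2 => [|w1 e IH] w2; first by move->.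
rewrite cat_rcons => wE; rewrite (IH _ wE) filter_rcons.
case: ifP => pe; first by rewrite cat_rcons.
rewrite -[e :: w2]/([:: e] ++ w2); apply: gd => l; rewrite inE => /eqP ->.
move: pe; rewrite /p wE => /negbT; apply: contraNN.
by rewrite !mem_cat mem_filter !inE => /or3P[/andP[_ ->]|->|->]; rewrite ?orbT.
Qed.

Lemma droppable_perm (T : Type) (g : seq endpoint -> T) w w' : droppable g ->
  perm_eq w w' ->
  [seq e <- w | mate e \in w] = [seq e <- w' | mate e \in w] -> g w = g w'.
Proof.
move=> gd ww' e; rewrite (droppable_clean w gd) (droppable_clean w' gd) e.
by congr g; apply: eq_filter => l; rewrite (perm_mem ww').
Qed.

Lemma filter_swap (T : eqType) (p : pred T) a b :
  ~~ (p a && p b) -> filter p [:: a; b] = filter p [:: b; a].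
Proof. by rewrite /=; case: (p a) (p b) => [] []. Qed.

Lemma filter_swap_if (T : eqType) (p : pred T) (c : bool) a b :
  (c -> ~~ (p a && p b)) ->
  filter p (if c then [:: a; b] else [::]) = filter p (if c then [:: b; a] else [::]).
Proof. by case: c => // h; apply: filter_swap; apply: h. Qed.

Section Triangle.
Variable B : comAlgType {poly rat}.
Implicit Types (wt : nat -> option bool) (g G : seq endpoint -> B).
Implicit Types (e f : endpoint) (s x y z t : seq endpoint).

Lemma state_sum_cut_rot wt g w a b e s1 s2 : rot_inv g -> uniq w ->
  w = a ++ b -> b ++ a = e :: s1 ++ mate e :: s2 ->
  state_sum wt g w = state_sum (uncut wt e) g w
    + mean (cut wt e (expand wt g g s1) * expand wt g g s2).
Proof.
move=> gr uw ew eba; have uba : uniq (e :: s1 ++ mate e :: s2).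
  by rewrite -eba uniq_catC -ew.
have rotE wt' : state_sum wt' g w = state_sum wt' g (e :: s1 ++ mate e :: s2).
  by rewrite ew state_sum_catC -?eba // -ew.
by rewrite !rotE state_sum_cut.
Qed.

Lemma cut_uncut wt e f (p : {poly B}) : f.1 != e.1 -> cut (uncut wt e) f p = cut wt f p.
Proof. by move=> ne; apply: eq_cut => //; rewrite /uncut (negbTE ne). Qed.

Lemma cut_uncut_id wt e (p : {poly B}) : cut (uncut wt e) e p = 0.
Proof. by rewrite cut_None // /uncut eqxx. Qed.

Lemma neq_arrow e f : e != f -> mate e != f -> e.1 != f.1.
Proof.
by case: e f => i b [j c]; rewrite /mate -!pair_eqE /= => h1 h2; apply/eqP => ij;
  move: h1 h2; rewrite ij eqxx; case: b c {ij} => [] [].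
Qed.

Lemma self_mate e : (e == mate e) = false.
Proof. by rewrite eq_sym mate_neq. Qed.

(** The three arrows are named by endpoints [o], [q], [r] of the same kind.  If these are
    tails, move (c) for one cyclic order goes from the unlinked to the linked triangle;
    if they are heads, move (c) for the other cyclic order goes the opposite way. *)
Definition unlinked_triangle (o q r : endpoint) x y t :=
  mate o :: q :: x ++ mate q :: r :: y ++ mate r :: o :: t.
Definition linked_triangle (o q r : endpoint) x y t :=
  q :: mate o :: x ++ r :: mate q :: y ++ o :: mate r :: t.

Section Fixed.
Variables (wt : nat -> option bool) (g : seq endpoint -> B).
Hypotheses (g0 : g [::] = 0) (gdrop : droppable g) (grot : rot_inv g).
Hypotheses (gkink : kink_inv g) (gslide : slide_inv g).
Variables (o q r : endpoint) (x y t : seq endpoint).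
Hypothesis uN : uniq (unlinked_triangle o q r x y t).
Hypothesis (oq2 : o.2 = q.2) (qr2 : q.2 = r.2).
Hypothesis cutE : forall a b c : {poly B},
  mean (cut wt q a * (cut wt r b * c)) + mean (cut wt q a * (cut wt o c * b))
  + mean (cut wt r b * (cut wt o c * a)) = 0.
Hypothesis gE : forall x' y' t', subseq x' x -> subseq y' y -> subseq t' t ->
  (x', y', t') <> (x, y, t) ->
  g (unlinked_triangle o q r x' y' t') = g (linked_triangle o q r x' y' t').
Local Notation Y := (expand wt g g).
Local Notation N := (unlinked_triangle o q r x y t).
Local Notation C := (linked_triangle o q r x y t).

Let u6 : uniq ([:: o; mate o; q; mate q; r; mate r] ++ x ++ y ++ t).
Proof. by have := uN; rewrite /unlinked_triangle => h; uniq_from h. Qed.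
Let uC : uniq C.
Proof. by rewrite /linked_triangle; uniq_from u6. Qed.

Let w3 := uncut (uncut (uncut wt q) r) o.

(** By [expand_chain], cutting one arrow of the triangle removes the other two or cuts one
    of them as well; the terms with two cuts cancel by [cutE]. *)
Lemma state_sum_unlinked : state_sum wt g N = state_sum w3 g N
  + mean (cut wt q (Y x) * Y (y ++ t)) + mean (cut wt r (Y y) * Y (t ++ x))
  + mean (cut wt o (Y t) * Y (x ++ y)).
Proof.
have [uq ur uo] : [/\ uniq (q :: [:: o; mate o; mate q; r; mate r] ++ x ++ y ++ t),
    uniq (r :: [:: o; mate o; q; mate q; mate r] ++ x ++ y ++ t) &
    uniq (o :: [:: mate o; q; mate q; r; mate r] ++ x ++ y ++ t)].
  by split; uniq_from u6.
move: uq ur uo; rewrite /= !inE !mem_cat !negb_or.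
case/andP=> /and5P[qo qo' _ qr /and4P[qr' qx qy qt]] _.
case/andP=> /and5P[ro ro' rq rq' /and4P[_ rx ry rt]] _.
case/andP=> /and5P[_ oq oq' or_ /and4P[or' ox oy ot]] _.
have nrq : r.1 != q.1 by apply: neq_arrow; rewrite ?mate_eq.
have noq : o.1 != q.1 by apply: neq_arrow; rewrite ?mate_eq.
have nor : o.1 != r.1 by apply: neq_arrow; rewrite ?mate_eq.
have Y1 G z : q \notin z -> expand (uncut wt q) g G z = expand wt g G z.
  by move=> qz; apply: expand_uncut; rewrite qz.
have Y2 G z : q \notin z -> r \notin z ->
    expand (uncut (uncut wt q) r) g G z = expand wt g G z.
  by move=> qz rz; rewrite expand_uncut ?rz ?Y1.
(* The base point is moved in turn before [q], [r] and [o], and the terms that cut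
   the arrow there are separated. *)
rewrite (@state_sum_cut_rot wt g N [:: mate o] (q :: x ++ mate q :: r :: y ++ mate r :: o :: t)
  q x (r :: y ++ mate r :: o :: rcons t (mate o)) grot uN) //; last first.
  by rewrite /= -cats1 -!catA /= -!catA.
rewrite (@state_sum_cut_rot (uncut wt q) g N (mate o :: q :: rcons x (mate q))
  (r :: y ++ mate r :: o :: t) r y (o :: t ++ mate o :: q :: rcons x (mate q)) grot uN) //; first last.
- by rewrite /= -!catA /=.
- by rewrite /unlinked_triangle /= cat_rcons.
rewrite (@state_sum_cut_rot (uncut (uncut wt q) r) g N (mate o :: q :: x ++ mate q :: r :: rcons y (mate r))
  (o :: t) o t (q :: x ++ mate q :: r :: rcons y (mate r)) grot uN) //; last first.
  by rewrite /unlinked_triangle /= -!catA /= cat_rcons.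
rewrite !expand_chain //; try by [rewrite oq2 qr2|rewrite oq2]; try by uniq_from u6.
have E1 (p : {poly B}) : cut (uncut (uncut wt q) r) q p = 0.
  by rewrite cut_uncut ?cut_uncut_id // eq_sym.
have E2 (p : {poly B}) : cut (uncut wt q) r p = cut wt r p by rewrite cut_uncut.
have E3 (p : {poly B}) : cut (uncut wt q) o p = cut wt o p by rewrite cut_uncut.
have E4 (p : {poly B}) : cut (uncut (uncut wt q) r) o p = cut wt o p by rewrite !cut_uncut.
rewrite E1 !cut_uncut_id E2 E3 E4 !mul0r !addr0.
rewrite !Y2 // ?Y1 //; try by rewrite ?mem_cat ?negb_or ?qx ?qy ?qt ?rx ?ry ?rt.
  move: (cutE (Y x) (Y y) (Y t)) => cutY.
  rewrite !mulrDr !meanD -[RHS]addr0 -cutY.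
  by rewrite /w3; ring.
- have : uniq ((r :: y ++ [:: mate r, o & rcons t (mate o)]) ++ [:: q; mate q] ++ x) by uniq_from u6.
  by rewrite cat_uniq => /and3P[].
- have : uniq ((o :: t ++ [:: mate o, q & rcons x (mate q)]) ++ [:: r; mate r] ++ y) by uniq_from u6.
  by rewrite cat_uniq => /and3P[].
- have : uniq ((q :: x ++ [:: mate q, r & rcons y (mate r)]) ++ [:: o; mate o] ++ t) by uniq_from u6.
  by rewrite cat_uniq => /and3P[].
Qed.

(** Cutting one arrow of the linked triangle discards the other two. *)
Lemma state_sum_linked : state_sum wt g C = state_sum w3 g C
  + mean (cut wt q (Y x) * Y (y ++ t)) + mean (cut wt r (Y y) * Y (t ++ x))
  + mean (cut wt o (Y t) * Y (x ++ y)).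
Proof.
have fresh e f s z : uniq (e :: f :: mate e :: mate f :: s ++ z) ->
  {in [:: e; f], forall l, mate l \notin s ++ [:: e; f] ++ z}.
  rewrite /= !inE !mem_cat !negb_or.
  case/and5P=> /and5P[ef _ ef' es ez] /and4P[fe _ fs fz] /and3P[_ es' ez'] /andP[fs' fz'] _ l.
  rewrite !inE => /orP[] /eqP ->; rewrite !(mem_cat, inE) !negb_or mate_neq mate_eq.
    by rewrite es' ez' ef'.
  by rewrite fs' fz' fe.
have dropE wt' e f s z : uniq (e :: f :: mate e :: mate f :: s ++ z) ->
    expand wt' g g (s ++ e :: f :: z) = expand wt' g g (s ++ z).
  by move=> us; apply: (@expand_drop_id _ wt' g s [:: e; f] z gdrop); apply: fresh.
have drop1 wt' e s z : mate e \notin s ++ e :: z ->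
    expand wt' g g (s ++ e :: z) = expand wt' g g (s ++ z).
  move=> es; apply: (@expand_drop_id _ wt' g s [:: e] z gdrop) => l.
  by rewrite inE => /eqP ->.
have dropE' wt' e f s : uniq (e :: f :: mate e :: mate f :: s) ->
    expand wt' g g (e :: rcons s f) = expand wt' g g s.
  move=> us; rewrite -[e :: _]/([::] ++ e :: rcons s f) drop1 ?cats0 //=.
    rewrite -[in RHS](cats0 s) -cats1 drop1 ?cats0 //.
    have : uniq ((mate f :: (s ++ [:: f])) ++ [:: e; mate e]) by uniq_from us.
    by rewrite cat_uniq => /and3P[/andP[]].
  have : uniq ((mate e :: (e :: rcons s f)) ++ [:: mate f]) by uniq_from us.
  by rewrite cat_uniq => /and3P[/andP[]].
have [uq ur uo] : [/\ uniq (q :: [:: o; mate o; mate q; r; mate r] ++ x ++ y ++ t),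
    uniq (r :: [:: o; mate o; q; mate q; mate r] ++ x ++ y ++ t) &
    uniq (o :: [:: mate o; q; mate q; r; mate r] ++ x ++ y ++ t)].
  by split; uniq_from u6.
move: uq ur uo; rewrite /= !inE !mem_cat !negb_or.
case/andP=> /and5P[qo qo' _ qr /and4P[qr' qx qy qt]] _.
case/andP=> /and5P[ro ro' rq rq' /and4P[_ rx ry rt]] _.
case/andP=> /and5P[_ oq oq' or_ /and4P[or' ox oy ot]] _.
have nrq : r.1 != q.1 by apply: neq_arrow; rewrite ?mate_eq.
have noq : o.1 != q.1 by apply: neq_arrow; rewrite ?mate_eq.
have nor : o.1 != r.1 by apply: neq_arrow; rewrite ?mate_eq.
have Y1 G z : q \notin z -> expand (uncut wt q) g G z = expand wt g G z.
  by move=> qz; apply: expand_uncut; rewrite qz.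
have Y2 G z : q \notin z -> r \notin z ->
    expand (uncut (uncut wt q) r) g G z = expand wt g G z.
  by move=> qz rz; rewrite expand_uncut ?rz ?Y1.
(* As for the unlinked triangle, the arrows of [q], [r] and [o] are treated in turn. *)
rewrite (@state_sum_cut_rot wt g C [::] C
  q (mate o :: rcons x r) (y ++ o :: mate r :: t) grot uC) //; last first.
  by rewrite cats0 /linked_triangle /= cat_rcons.
rewrite (@state_sum_cut_rot (uncut wt q) g C (q :: mate o :: x)
  (r :: mate q :: y ++ o :: mate r :: t) r (mate q :: rcons y o) (t ++ q :: mate o :: x) grot uC) //; last first.
  by rewrite /= -!catA /= cat_rcons.
rewrite (@state_sum_cut_rot (uncut (uncut wt q) r) g C (q :: mate o :: x ++ r :: mate q :: y)
  (o :: mate r :: t) o (mate r :: rcons t q) (x ++ r :: mate q :: y) grot uC) //; first last.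
- by rewrite /= cat_rcons.
- by rewrite /linked_triangle /= -!catA.
have usub (a b : seq endpoint) : uniq (a ++ b) -> uniq a by rewrite cat_uniq => /and3P[].
rewrite !dropE' ?dropE ?mateK;
  try (by apply: (usub _ ([:: q; mate q] ++ y ++ t)); uniq_from u6);
  try (by apply: (usub _ ([:: q; mate q] ++ x)); uniq_from u6);
  try (by apply: (usub _ ([:: r; mate r] ++ x ++ t)); uniq_from u6);
  try (by apply: (usub _ ([:: r; mate r] ++ y)); uniq_from u6);
  try (by apply: (usub _ ([:: o; mate o] ++ x ++ y)); uniq_from u6);
  try (by apply: (usub _ ([:: o; mate o] ++ t)); uniq_from u6).
have E2 (p : {poly B}) : cut (uncut wt q) r p = cut wt r p by rewrite cut_uncut.
have E4 (p : {poly B}) : cut (uncut (uncut wt q) r) o p = cut wt o p by rewrite !cut_uncut.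
rewrite E2 E4 !Y2 // ?Y1 //; try by rewrite ?mem_cat ?negb_or ?qx ?qy ?qt ?rx ?ry ?rt.
by rewrite /w3; ring.
Qed.

(** By the two preceding lemmas only the terms without a cut in the triangle remain.  A
    component that does not carry the whole triangle carries at most one complete arrow
    of it, and then the move does not change its reduced word. *)
Lemma state_sum_triangle : state_sum wt g N = state_sum wt g C + (g N - g C).
Proof.
rewrite state_sum_unlinked state_sum_linked.
suff -> : state_sum w3 g N = state_sum w3 g C + (g N - g C) by ring.
have w3N : [/\ w3 q.1 = None, w3 r.1 = None & w3 o.1 = None].
  by rewrite /w3 /uncut !eqxx; split; do ?case: eqP.
case: w3N => wq wr wo.
rewrite /state_sum /unlinked_triangle /linked_triangle !expand_keep; try by left.
rewrite -[X in _ = _ + X]meanC -meanD; congr mean.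
have [uq [ur [uo [uq' [ur' uo']]]]] :
   uniq (q :: [:: o; mate o; mate q; r; mate r] ++ x ++ y ++ t) /\
   uniq (r :: [:: o; mate o; q; mate q; mate r] ++ x ++ y ++ t) /\
   uniq (o :: [:: mate o; q; mate q; r; mate r] ++ x ++ y ++ t) /\
   uniq (mate q :: [:: o; mate o; q; r; mate r] ++ x ++ y ++ t) /\
   uniq (mate r :: [:: o; mate o; q; mate q; r] ++ x ++ y ++ t) /\
   uniq (mate o :: [:: o; q; mate q; r; mate r] ++ x ++ y ++ t).
  by do 5?split; uniq_from u6.
move: uq ur uo uq' ur' uo'; rewrite /= !inE !mem_cat !negb_or.
case/andP=> /and5P[qo qo' _ qr /and4P[qr' qx qy qt]] _.
case/andP=> /and5P[ro ro' rq rq' /and4P[_ rx ry rt]] _.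
case/andP=> /and5P[_ oq oq' or_ /and4P[or' ox oy ot]] _.
case/andP=> /and5P[_ _ _ _ /and4P[_ q'x q'y q't]] _.
case/andP=> /and5P[_ _ _ _ /and4P[_ r'x r'y r't]] _.
case/andP=> /and5P[_ _ _ _ /and4P[_ o'x o'y o't]] _.
have F2 := (mate_neq, inj_eq (inv_inj mateK), mate_eq, negbTE qr, negbTE qo, negbTE oq,
  negbTE ro, negbTE rq, negbTE or_, negbTE qo', negbTE oq', negbTE qr', negbTE rq',
  negbTE ro', negbTE or', self_mate).
have notT a : a \in x ++ y ++ t ->
    [&& a != q, a != mate q, a != r, a != mate r, a != o & a != mate o].
  move=> axyt; do ?[apply/andP; split]; apply/eqP => ea; move: axyt; rewrite ea !mem_cat;
  apply/negP; rewrite !negb_or ?qx ?qy ?qt ?q'x ?q'y ?q't ?rx ?ry ?rt ?r'x ?r'y ?r't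
    ?ox ?oy ?ot ?o'x ?o'y ?o't //.
have sub6 x' y' t' : subseq x' x -> subseq y' y -> subseq t' t ->
  [/\ [&& q \notin x', q \notin y' & q \notin t'],
   [&& r \notin x', r \notin y' & r \notin t'],
   [&& o \notin x', o \notin y' & o \notin t']
   & [/\ [&& mate q \notin x', mate q \notin y' & mate q \notin t'],
   [&& mate r \notin x', mate r \notin y' & mate r \notin t'] &
   [&& mate o \notin x', mate o \notin y' & mate o \notin t']]].
  move=> sx sy st; (split; last split); apply/and3P; split;
    by first [apply: notin_subseq sx _ | apply: notin_subseq sy _ | apply: notin_subseq st _].
apply: (@expand_replace2 _ w3 g _ _ _ x y t [:: mate q; r] [:: r; mate q]
  [:: mate r; o] [:: o; mate r]).
- by move=> l; rewrite mem_cat !inE => /orP[] /orP[] /eqP ->; left.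
- by move=> l; rewrite mem_cat !inE => /orP[] /orP[] /eqP ->; left.
- move=> a /notT/and5P[aq aq' ar ar' /andP[ao ao']].
  by rewrite !inE !negb_or !(inj_eq (inv_inj mateK)) !mate_eq aq ar ar' ao'.
- move=> b c x' y' t' sx sy st.
  case: (sub6 _ _ _ sx sy st) => /and3P[qx' qy' qt'] /and3P[rx' ry' rt'] /and3P[ox' oy' ot'].
  case=> /and3P[q'x' q'y' q't'] /and3P[r'x' r'y' r't'] /and3P[o'x' o'y' o't'].
  have F := (negbTE qx', negbTE qy', negbTE qt', negbTE rx', negbTE ry', negbTE rt',
    negbTE ox', negbTE oy', negbTE ot', negbTE q'x', negbTE q'y', negbTE q't',
    negbTE r'x', negbTE r'y', negbTE r't', negbTE o'x', negbTE o'y', negbTE o't').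
  apply: droppable_perm => //; first by case: b c => [] []; perm_by_count.
  rewrite !filter_cat; congr (_ ++ _ ++ _ ++ _ ++ _); [case: b c|case: b c] => [] [] //;
    apply: filter_swap; rewrite !(mem_cat, inE, mateK, F, F2) /= ?andbF //.
- move=> b c x' y' t' sx sy st.
  case: (sub6 _ _ _ sx sy st) => /and3P[qx' qy' qt'] /and3P[rx' ry' rt'] /and3P[ox' oy' ot'].
  case=> /and3P[q'x' q'y' q't'] /and3P[r'x' r'y' r't'] /and3P[o'x' o'y' o't'].
  have F := (negbTE qx', negbTE qy', negbTE qt', negbTE rx', negbTE ry', negbTE rt',
    negbTE ox', negbTE oy', negbTE ot', negbTE q'x', negbTE q'y', negbTE q't',
    negbTE r'x', negbTE r'y', negbTE r't', negbTE o'x', negbTE o'y', negbTE o't').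
  move=> nfull; have [eb|eb] : (b && c) \/ ~~ (b && c) by case: (b && c); [left|right].
    by case/andP: eb nfull => -> -> nfull; apply: gE => // -[ex ey et]; apply: nfull; rewrite ex ey et.
  apply: droppable_perm => //; first by case: b c {nfull eb} => [] []; perm_by_count.
  set u := x' ++ _; set v := x' ++ _.
  change ([seq e <- [:: mate o; q] ++ u | mate e \in [:: mate o; q] ++ u] =
    [seq e <- [:: q; mate o] ++ v | mate e \in [:: mate o; q] ++ u]).
  rewrite !filter_cat; congr (_ ++ _ ++ _ ++ _ ++ _ ++ _).
  - apply: filter_swap; rewrite !(mem_cat, inE, mateK, F, F2) /= ?andbF //.
    by case: b c eb {nfull u v} => [] [] //= _; rewrite ?(inE, F2) ?eqxx.
  - apply: filter_swap_if => bT; rewrite /u !(mem_cat, inE, mateK, F, F2) /= ?andbF //.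
    by case: c eb {nfull u v} => [|_]; rewrite bT //= !(inE, F2) ?andbF.
  - apply: filter_swap_if => cT; rewrite /u !(mem_cat, inE, mateK, F, F2) /= ?andbF //.
    by case: b eb {nfull u v} => [|_]; rewrite cT //= !(inE, F2) ?andbF.
- by rewrite /= addrC subrK.
Qed.

End Fixed.
End Triangle.

(** * From words to strings *)

Definition clean (w : seq endpoint) : seq endpoint := [seq e <- w | mate e \in w].

Lemma gaussE w : gauss w = uniq w && (clean w == w).
Proof.
rewrite /gauss /clean; congr (_ && _).
by apply/idP/eqP => [/all_filterP|] //; move/all_filterP.
Qed.

Lemma clean_uniq w : uniq w -> uniq (clean w).
Proof. exact: filter_uniq. Qed.

Lemma mem_clean e w : (e \in clean w) = (mate e \in w) && (e \in w).
Proof. by rewrite mem_filter. Qed.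

Lemma gauss_clean w : uniq w -> gauss (clean w).
Proof.
move=> uw; rewrite /gauss clean_uniq //; apply/allP => e.
by rewrite mem_clean -/(mate e) mem_clean mateK => /andP[-> ->].
Qed.

Lemma cleanK w : gauss w -> clean w = w.
Proof. by rewrite gaussE => /andP[_ /eqP]. Qed.

Lemma gauss_uniq w : gauss w -> uniq w.
Proof. by case/andP. Qed.

Lemma gauss_mate w e : gauss w -> (mate e \in w) = (e \in w).
Proof.
case/andP=> _ /allP h; apply/idP/idP => [/h|/h]; last by [].
by rewrite -/(mate (mate e)) mateK.
Qed.

Lemma size_clean w : (size (clean w) <= size w)%N.
Proof. by rewrite size_filter count_size. Qed.

(** The string carried by a component.  The default value concerns words with
    repetitions, which do not occur as components. *)
Definition cleaned (w : seq endpoint) : vstring := insubd trivial_string (clean w).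

Lemma cleanedE w : uniq w -> cleaned w = clean w :> seq endpoint.
Proof. by move=> uw; rewrite /cleaned val_insubd gauss_clean. Qed.

Lemma cleanedK (v : vstring) : cleaned v = v.
Proof. by apply: val_inj; rewrite /cleaned val_insubd cleanK ?endpointsP. Qed.

Lemma cleaned_clean w : cleaned (clean w) = cleaned w.
Proof.
rewrite /cleaned; have [gw|ngw] := boolP (gauss (clean w)); first by rewrite cleanK.
congr insubd; apply/all_filterP/allP => e.
by rewrite mem_clean mem_clean mateK => /andP[-> ->].
Qed.

Lemma size_cleaned w : (size (cleaned w) <= size w)%N.
Proof.
rewrite /cleaned val_insubd; case: ifP => // _; exact: size_clean.
Qed.

Lemma clean_drop x b y : {in b, forall e, mate e \notin x ++ b ++ y} ->
  clean (x ++ b ++ y) = clean (x ++ y).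
Proof.
move=> nb; rewrite /clean !filter_cat.
have -> : [seq e <- b | mate e \in x ++ b ++ y] = [::].
  by rewrite -(filter_pred0 b); apply: eq_in_filter => e /nb /negbTE.
have E e : e \in x ++ y -> (mate e \in x ++ b ++ y) = (mate e \in x ++ y).
  move=> exy; rewrite !mem_cat; case: (boolP (mate e \in b)) => // /nb.
  by rewrite mateK !mem_cat; move: exy; rewrite mem_cat => /orP[->|->]; rewrite ?orbT.
congr (_ ++ _); apply: eq_in_filter => e exy; apply: E; rewrite mem_cat exy ?orbT //.
Qed.

Lemma size_subseq_lt (T : eqType) (q s : seq T) :
  subseq q s -> q <> s -> (size q < size s)%N.
Proof.
by move=> qs nqs; rewrite (ltn_leqif (size_subseq_leqif qs)); apply/eqP.
Qed.

Section Lift.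
Variable T : Type.
Implicit Types (psi : vstring -> T) (n : nat).

Definition on_words psi (w : seq endpoint) : T := psi (cleaned w).

Lemma on_words_droppable psi : droppable (on_words psi).
Proof.
by move=> x b y nb; rewrite /on_words -cleaned_clean clean_drop // cleaned_clean.
Qed.

Lemma on_wordsK psi (v : vstring) : on_words psi v = psi v.
Proof. by rewrite /on_words cleanedK. Qed.

(** The invariances are stated up to a given number of endpoints, so that those of
    [string_lift] can be established by induction. *)
Definition homeo_inv n psi := forall f (v w : vstring),
  (size v < n)%N -> homeo f v w -> psi v = psi w.
Definition kink_inv_below n psi := forall e (v w : vstring),
  (size w < n)%N -> w = e :: mate e :: v :> seq endpoint -> psi w = psi v.
Definition slide_inv_below n psi := forall e f x t y (v w : vstring),
  (size w < n)%N -> e.2 != f.2 -> perm_eq t [:: mate e; mate f] ->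
  w = e :: f :: x ++ t ++ y :> seq endpoint -> v = x ++ y :> seq endpoint ->
  psi w = psi v.
Definition triangle_inv_below n psi := forall o q r x y t (v w : vstring),
  (size w < n)%N -> o.2 = q.2 -> q.2 = r.2 ->
  w = unlinked_triangle o q r x y t :> seq endpoint ->
  v = linked_triangle o q r x y t :> seq endpoint -> psi w = psi v.

Lemma homeo_rcons e s : homeo id (cleaned (e :: s)) (cleaned (rcons s e)).
Proof.
split=> [//|]; rewrite (eq_map (g := id)) ?map_id; last by case.
have E1 : clean (e :: s) = (if mate e \in s then [:: e] else [::]) ++ [seq l <- s | mate l \in e :: s].
  by rewrite /clean /= inE mate_neq /=; case: ifP.
have E2 : clean (rcons s e) = [seq l <- s | mate l \in e :: s] ++ (if mate e \in s then [:: e] else [::]).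
  rewrite /clean -cats1 filter_cat /= mem_cat mem_seq1 mate_neq orbF; congr (_ ++ _).
  by apply: eq_filter => l; rewrite !(mem_cat, inE) orbC.
have E3 : uniq (clean (e :: s)) = uniq (clean (rcons s e)) by rewrite E1 E2 uniq_catC.
have gE w : gauss (clean w) = uniq (clean w).
  rewrite gaussE; case: (uniq _) => //=; apply/eqP/all_filterP/allP => l.
  by rewrite mem_clean mem_clean mateK => /andP[-> ->].
rewrite /cleaned !val_insubd !gE -E3; case: ifP => _; last by exists 0%N.
rewrite E1 E2; case: (mate e \in s); last by exists 0%N; rewrite rot0 cats0.
by exists 1%N; rewrite rot1_cons cats1.
Qed.

Lemma homeo_relabel f w : {in w &, forall x y, f x.1 = f y.1 -> x.1 = y.1} ->
  uniq w -> homeo f (cleaned w) (cleaned (map (relabel f) w)).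
Proof.
move=> fI uw.
have fI' : {in w &, injective (relabel f)}.
  by move=> [i b] [j c] iw jw [/(fI _ _ iw jw) /= -> ->].
rewrite !cleanedE //; last by rewrite map_inj_in_uniq.
split=> [i j|].
  by rewrite !mem_clean => /andP[_ iw] /andP[_ jw]; exact: (fI _ _ iw jw).
exists 0%N; rewrite rot0 -/(relabel f) /clean filter_map; congr map.
apply: eq_in_filter => e ew /=.
apply/mapP/idP => [[l lw el]|ew']; last by exists (mate e).
move: el; rewrite /relabel /mate /= => -[/(fI _ _ ew lw) -> ->].
by case: l lw.
Qed.

Lemma on_words_rcons n psi e s : homeo_inv n psi -> (size (e :: s) < n)%N ->
  on_words psi (e :: s) = on_words psi (rcons s e).
Proof.
move=> hpsi sn; apply: hpsi (homeo_rcons e s).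
exact: leq_ltn_trans (size_cleaned _) sn.
Qed.

Lemma clean_kink e s : uniq (e :: mate e :: s) ->
  clean (e :: mate e :: s) = e :: mate e :: clean s.
Proof.
rewrite /= inE negb_or => /and3P[/andP[_ es] e's us].
rewrite /clean /= !inE mateK !eqxx /= orbT; congr (_ :: _ :: _).
apply: eq_in_filter => l ls; rewrite !inE mate_eq (inj_eq (inv_inj mateK)).
by case: eqP => [le|_]; [rewrite -le ls in e's|case: eqP => [le|//]; rewrite -le ls in es].
Qed.

Lemma on_words_kink n psi e s : kink_inv_below n psi ->
  (size (e :: mate e :: s) < n)%N -> uniq (e :: mate e :: s) ->
  on_words psi (e :: mate e :: s) = on_words psi s.
Proof.
move=> kpsi sn us; apply: (kpsi e); first exact: leq_ltn_trans (size_cleaned _) sn.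
by rewrite !cleanedE ?clean_kink //; case/and3P: us.
Qed.

(** Endpoints outside a union [b] of complete arrows find their mates in the rest [z]. *)
Lemma clean_split (w b z : seq endpoint) : perm_eq w (b ++ z) ->
  {in b, forall e, mate e \in b} ->
  [/\ {in b, forall e, mate e \in w},
      {in z, forall e, e \notin b -> (mate e \in w) = (mate e \in z)}
    & uniq w -> {in z, forall e, e \notin b}].
Proof.
move=> /[dup] /perm_mem wE /perm_uniq uE mb; split.
- by move=> e eb; rewrite wE mem_cat mb.
- move=> e ez neb; rewrite wE mem_cat; case: (boolP (mate e \in b)) => // /mb.
  by rewrite mateK (negbTE neb).
- rewrite uE cat_uniq => /and3P[_ /hasPn nz _] e /nz //.
Qed.

Lemma clean_slide e f x t y : perm_eq t [:: mate e; mate f] ->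
  uniq (e :: f :: x ++ t ++ y) ->
  let p l := mate l \in x ++ y in
  clean (e :: f :: x ++ t ++ y) = e :: f :: filter p x ++ t ++ filter p y.
Proof.
move=> pt uw p; set w := e :: _.
have pw : perm_eq w ([:: e; f; mate e; mate f] ++ x ++ y).
  apply/permP => a; rewrite /w /= !count_cat (permP pt) /=; ring.
have hb : {in [:: e; f; mate e; mate f], forall l, mate l \in [:: e; f; mate e; mate f]}.
  by move=> l; rewrite !inE => /or4P[] /eqP ->; rewrite ?mateK eqxx ?orbT.
have [h1 h2 h3] := clean_split pw hb.
have ht l : l \in t -> mate l \in w.
  rewrite (perm_mem pt) => lt; apply: h1; move: lt; rewrite !inE.
  by case/orP=> ->; rewrite ?orbT.
have he : mate e \in w by apply: h1; rewrite !inE eqxx.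
have hf : mate f \in w by apply: h1; rewrite !inE eqxx orbT.
rewrite /clean {1}/w /= he hf !filter_cat; congr (_ :: _ :: _ ++ _ ++ _).
- apply: eq_in_filter => l lx; have lxy : l \in x ++ y by rewrite mem_cat lx.
  by rewrite h2 // h3.
- by apply/all_filterP/allP.
- apply: eq_in_filter => l lx; have lxy : l \in x ++ y by rewrite mem_cat lx orbT.
  by rewrite h2 // h3.
Qed.

Lemma on_words_slide n psi e f x t y : slide_inv_below n psi ->
  (size (e :: f :: x ++ t ++ y) < n)%N -> e.2 != f.2 ->
  perm_eq t [:: mate e; mate f] -> uniq (e :: f :: x ++ t ++ y) ->
  on_words psi (e :: f :: x ++ t ++ y) = on_words psi (x ++ y).
Proof.
move=> spsi sn ef pt us; pose p l := mate l \in x ++ y.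
have uxy : uniq (x ++ y).
  apply: subseq_uniq us; rewrite -[e :: _]/([:: e; f] ++ x ++ t ++ y) catA.
  by rewrite -[x ++ y]cat0s catA cat_subseq ?suffix_subseq // cat_subseq // sub0seq.
apply: (spsi e f (filter p x) t (filter p y)) => //.
- exact: leq_ltn_trans (size_cleaned _) sn.
- by rewrite cleanedE // clean_slide.
- by rewrite cleanedE // /clean filter_cat.
Qed.

Lemma clean_triangle o q r x y t : uniq (unlinked_triangle o q r x y t) ->
  let p l := mate l \in x ++ y ++ t in
  clean (unlinked_triangle o q r x y t) =
    unlinked_triangle o q r (filter p x) (filter p y) (filter p t) /\
  clean (linked_triangle o q r x y t) =
    linked_triangle o q r (filter p x) (filter p y) (filter p t).
Proof.
move=> uN p; set b := [:: o; mate o; q; mate q; r; mate r].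
have pN : perm_eq (unlinked_triangle o q r x y t) (b ++ x ++ y ++ t).
  by rewrite /unlinked_triangle /b; perm_by_count.
have pC : perm_eq (linked_triangle o q r x y t) (b ++ x ++ y ++ t).
  by rewrite /linked_triangle /b; perm_by_count.
have uC : uniq (linked_triangle o q r x y t).
  by rewrite (perm_uniq pC) -(perm_uniq pN).
have hb : {in b, forall l, mate l \in b}.
  move=> l; rewrite !inE => /orP[|/orP[|/or4P[]]] /eqP ->;
  by rewrite ?mateK !eqxx ?orbT.
have [h1 h2 h3] := clean_split pN hb.
have [k1 k2 k3] := clean_split pC hb.
have sx : {subset x <= x ++ y ++ t} by move=> l lx; rewrite mem_cat lx.
have sy : {subset y <= x ++ y ++ t} by move=> l lx; rewrite !mem_cat lx orbT.
have st : {subset t <= x ++ y ++ t} by move=> l lx; rewrite !mem_cat lx !orbT.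
have hE z : {subset z <= x ++ y ++ t} ->
    [seq l <- z | mate l \in unlinked_triangle o q r x y t] = filter p z.
  by move=> sz; apply: eq_in_filter => l /sz lz; rewrite h2 // h3.
have kE z : {subset z <= x ++ y ++ t} ->
    [seq l <- z | mate l \in linked_triangle o q r x y t] = filter p z.
  by move=> sz; apply: eq_in_filter => l /sz lz; rewrite k2 // k3.
have mb : [/\ o \in b, mate o \in b, q \in b & [/\ mate q \in b, r \in b & mate r \in b]].
  by rewrite !inE !eqxx !orbT.
case: mb => b1 b2 b3 [b4 b5 b6].
split.
  rewrite /clean {2}/unlinked_triangle.
  rewrite /= !filter_cat /= !filter_cat /= !hE // !h1 //.
rewrite /clean {2}/linked_triangle.
by rewrite /= !filter_cat /= !filter_cat /= !kE // !k1 //.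
Qed.

Lemma on_words_triangle n psi o q r x y t : triangle_inv_below n psi ->
  (size (unlinked_triangle o q r x y t) < n)%N -> o.2 = q.2 -> q.2 = r.2 ->
  uniq (unlinked_triangle o q r x y t) ->
  on_words psi (unlinked_triangle o q r x y t) =
  on_words psi (linked_triangle o q r x y t).
Proof.
move=> tpsi sn oq qr uN; pose p l := mate l \in x ++ y ++ t.
have [cN cC] := clean_triangle uN.
apply: (tpsi o q r (filter p x) (filter p y) (filter p t)) => //.
- exact: leq_ltn_trans (size_cleaned _) sn.
- by rewrite cleanedE // cN.
- have uC : uniq (linked_triangle o q r x y t).
    rewrite -(perm_uniq (_ : perm_eq (unlinked_triangle o q r x y t) _)) //.
    by rewrite /unlinked_triangle /linked_triangle; perm_by_count.
  by rewrite cleanedE.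
Qed.

End Lift.

Section Steps.
Variable B : comAlgType {poly rat}.
Implicit Types (psi : vstring -> B) (sg : nat -> bool) (v w : vstring).

Definition knot_sum psi sg v : B :=
  state_sum (fun i => Some (sg i)) (on_words psi) v.

Lemma on_words_nil psi : on_words psi [::] = psi trivial_string.
Proof. by rewrite -[[::]]/(endpoints trivial_string) on_wordsK. Qed.

(** Here and in the following lemmas, the state sums change by the change of the leading
    terms as soon as [psi] is invariant for the components with fewer arrows. *)
Lemma knot_sum_homeo n psi f v w sg sg' :
  homeo_inv n psi -> (size v <= n)%N -> homeo f v w ->
  (forall i, arrow_tail i \in endpoints v -> sg' (f i) = sg i) ->
  knot_sum psi sg v = knot_sum psi sg' w + (psi v - psi w).
Proof.
move=> hpsi vn [fI [k wE]] sgE.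
have tl (l : endpoint) : l \in endpoints v -> arrow_tail l.1 \in endpoints v.
  case: l => i [] // iv; rewrite -(gauss_mate _ (endpointsP v)) //.
have fI' : {in endpoints v &, forall x y, f x.1 = f y.1 -> x.1 = y.1}.
  by move=> l m /tl lv /tl mv /fI; apply.
set s := map (relabel f) v.
have us : uniq s.
  rewrite map_inj_in_uniq ?gauss_uniq ?endpointsP // => -[i b] [j c] iv jv.
  by case=> /(fI' _ _ iv jv) /= -> ->.
have rotE a b : uniq (a ++ b) -> (size (a ++ b) <= n)%N ->
  state_sum (fun i => Some (sg' i)) (on_words psi) (a ++ b) =
  state_sum (fun i => Some (sg' i)) (on_words psi) (b ++ a) +
    (on_words psi (a ++ b) - on_words psi (b ++ a)).
  elim: a b => [|e a IH] b uab sab; first by rewrite cats0 subrr addr0.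
  have uab' : uniq (a ++ rcons b e) by uniq_from uab.
  have sab' : (size (a ++ rcons b e) <= n)%N.
    by move: sab; rewrite !size_cat /= size_rcons addnS.
  rewrite cat_cons state_sum_rcons // ; last first.
    move=> q qs nqs; apply: on_words_rcons hpsi _.
    by apply: leq_trans sab; rewrite /= ltnS size_subseq_lt.
  rewrite rcons_cat IH // cat_rcons; ring.
have keyE : knot_sum psi sg v =
  state_sum (fun i => Some (sg' i)) (on_words psi) s + (psi v - on_words psi s).
  rewrite /knot_sum /state_sum -[X in _ = _ + X]meanC -meanD; congr mean.
  apply: expand_relabel => //.
  - by move=> l /tl lv; rewrite sgE.
  - move=> q qs nqs; apply: hpsi (homeo_relabel _ _).
    + apply: leq_trans vn; apply: leq_ltn_trans (size_cleaned _) _.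
      exact: size_subseq_lt.
    + by move=> l m /(mem_subseq qs) lv /(mem_subseq qs) mv; apply: fI'.
    + exact: subseq_uniq qs (gauss_uniq (endpointsP v)).
  - by rewrite on_wordsK addrC subrK.
rewrite keyE -[in X in X + _](cat_take_drop k s) rotE ?cat_take_drop //; last first.
  by rewrite size_map.
rewrite -[drop k s ++ _]/(rot k s) -wE on_wordsK /knot_sum; ring.
Qed.

End Steps.

Lemma ltn_add2 a a' b b' c : (a' <= a -> b' <= b -> (a' != a) || (b' != b) ->
  a' + (c + b') < a + (c + b))%N.
Proof. lia. Qed.

Lemma ltn_add3 a a' b b' c c' :
  (a' <= a -> b' <= b -> c' <= c -> [|| a' != a, b' != b | c' != c] ->
  (a' + (b' + c'.+2).+2) < (a + (b + c.+2).+2))%N.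
Proof. lia. Qed.

Section Steps.
Variable B : comAlgType {poly rat}.
Implicit Types (psi : vstring -> B) (sg : nat -> bool) (v w : vstring).

Lemma knot_sum_kink n psi e v w sg : psi trivial_string = 0 ->
  kink_inv_below n psi -> (size w <= n)%N ->
  w = e :: mate e :: v :> seq endpoint ->
  knot_sum psi sg w = knot_sum psi sg v + (psi w - psi v).
Proof.
move=> psi0 kpsi wn wE; have := gauss_uniq (endpointsP w).
rewrite -(on_wordsK psi w) -(on_wordsK psi v) /knot_sum wE => uw.
apply: state_sum_kink => //; first by rewrite on_words_nil.
move=> q qs nqs; apply: on_words_kink kpsi _ _.
  by rewrite wE /= in wn; apply: leq_trans wn; rewrite /= !ltnS size_subseq_lt.
by apply: subseq_uniq uw; rewrite /= !eqxx.
Qed.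

Definition homeo_invariant psi := forall n, homeo_inv n psi.
Definition kink_invariant psi := forall n, kink_inv_below n psi.
Definition slide_invariant psi := forall n, slide_inv_below n psi.

Lemma rot_inv_on_words psi : homeo_invariant psi -> rot_inv (on_words psi).
Proof. by move=> h e s; apply: on_words_rcons (h _) (ltnSn _). Qed.

Lemma kink_inv_on_words psi : kink_invariant psi -> kink_inv (on_words psi).
Proof. by move=> h e s; apply: on_words_kink (h _) (ltnSn _). Qed.

Lemma slide_inv_on_words psi : slide_invariant psi -> slide_inv (on_words psi).
Proof. by move=> h e f x t y; apply: on_words_slide (h _) (ltnSn _). Qed.

Lemma knot_sum_slide n psi e f x t y v w sg : psi trivial_string = 0 ->
  homeo_invariant psi -> kink_invariant psi -> slide_inv_below n psi ->
  (size w <= n)%N -> e.2 != f.2 -> perm_eq t [:: mate e; mate f] ->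
  w = e :: f :: x ++ t ++ y :> seq endpoint -> v = x ++ y :> seq endpoint ->
  sg f.1 = ~~ sg e.1 ->
  knot_sum psi sg w = knot_sum psi sg v + (psi w - psi v).
Proof.
move=> psi0 hpsi kpsi spsi wn ef pt wE vE sgE; have := gauss_uniq (endpointsP w).
rewrite -(on_wordsK psi w) -(on_wordsK psi v) /knot_sum /state_sum wE vE => uw.
rewrite wE in wn.
rewrite -[X in _ = _ + X]meanC -meanD; congr mean.
apply: expand_slide => //.
- by rewrite on_words_nil.
- exact: on_words_droppable.
- exact: rot_inv_on_words.
- exact: kink_inv_on_words.
- move=> p; rewrite /cut sgE; move: ef; case: (sg e.1) (e.2) (f.2) => [] [] [] //= _;
  by rewrite expr0 expr1; ring.
- move=> x' y' sx sy nxy; apply: (on_words_slide spsi) => //.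
  + apply: leq_trans wn; rewrite /= !ltnS !size_cat.
    have := size_subseq_leqif sx; have := size_subseq_leqif sy => -[ly ey] [lx ex].
    have : (x' != x) || (y' != y).
      rewrite -negb_and; apply/negP => /andP[/eqP xx /eqP yy].
      by apply: nxy; rewrite xx yy.
    by rewrite -ex -ey => h; apply: ltn_add2 lx ly h.
  + apply: subseq_uniq uw; rewrite -[e :: f :: x' ++ _]/([:: e; f] ++ x' ++ _).
    by rewrite -[e :: f :: x ++ _]/([:: e; f] ++ x ++ _) !cat_subseq.
Qed.

(** In both cyclic orders of move (c), the arrow that plays the third role is negative; it
    is [o] if the three endpoints are tails, and [q] if they are heads. *)
Definition triangle_signs (o q r : endpoint) sg : Prop :=
  if o.2 then [/\ sg o.1 = false, sg q.1 = true & sg r.1 = true]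
  else [/\ sg o.1 = true, sg q.1 = false & sg r.1 = true].

(** Two labels above (or below) a third one are ordered in one of two ways. *)
Lemma cut_triangle o q r sg (a b c : {poly B}) : o.2 = q.2 -> q.2 = r.2 ->
  triangle_signs o q r sg ->
  let ct := cut (fun i => Some (sg i)) in
  mean (ct q a * (ct r b * c)) + mean (ct q a * (ct o c * b))
  + mean (ct r b * (ct o c * a)) = 0.
Proof.
move=> oq qr; rewrite /triangle_signs; case o2: (o.2) => -[so sq sr] /=; rewrite /cut so sq sr -qr -oq o2 /=.
- have K3 : mean (integ_above a * integ_above b * c) =
     mean (integ_above a * integ_below c * b) + mean (integ_above b * integ_below c * a).
    by rewrite integ_aboveM mean_above -meanD; congr mean; ring.
  set X : {poly B} := ('X%:A)%:P.
  have -> : X * (-1) ^+ 0 * integ_above a * (X * (-1) ^+ 0 * integ_above b * c) =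
    ('X%:A * 'X%:A)%:P * (integ_above a * integ_above b * c).
    by rewrite polyCM -/X expr0; ring.
  have E (u s t : {poly B}) : X * (-1) ^+ 0 * u * (X * (-1) ^+ 1 * s * t) =
    ('X%:A * 'X%:A)%:P * (- (u * s * t)).
    by rewrite polyCM -/X expr0 expr1; ring.
  by rewrite !E !meanCM !meanN K3; ring.
- have K3 : mean (integ_below b * integ_below c * a) =
     mean (integ_above a * integ_below b * c) + mean (integ_above a * integ_below c * b).
    by rewrite integ_belowM mulrC -integ_belowD -mean_above -meanD; congr mean; ring.
  set X : {poly B} := ('X%:A)%:P.
  have -> : X * (-1) ^+ 0 * integ_below b * (X * (-1) ^+ 0 * integ_below c * a) =
    ('X%:A * 'X%:A)%:P * (integ_below b * integ_below c * a).
    by rewrite polyCM -/X expr0; ring.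
  have E (u s t : {poly B}) : X * (-1) ^+ 1 * u * (X * (-1) ^+ 0 * s * t) =
    ('X%:A * 'X%:A)%:P * (- (u * s * t)).
    by rewrite polyCM -/X expr0 expr1; ring.
  by rewrite !E !meanCM !meanN K3; ring.
Qed.

Lemma knot_sum_triangle n psi o q r x y t v w sg : psi trivial_string = 0 ->
  homeo_invariant psi -> kink_invariant psi -> slide_invariant psi ->
  triangle_inv_below n psi ->
  (size w <= n)%N -> o.2 = q.2 -> q.2 = r.2 -> triangle_signs o q r sg ->
  w = unlinked_triangle o q r x y t :> seq endpoint ->
  v = linked_triangle o q r x y t :> seq endpoint ->
  knot_sum psi sg w = knot_sum psi sg v + (psi w - psi v).
Proof.
move=> psi0 hpsi kpsi spsi tpsi wn oq qr sgE wE vE; have := gauss_uniq (endpointsP w).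
rewrite -(on_wordsK psi w) -(on_wordsK psi v) /knot_sum wE vE => uw.
rewrite wE in wn.
apply: state_sum_triangle => //.
- by rewrite on_words_nil.
- exact: on_words_droppable.
- exact: rot_inv_on_words.
- exact: kink_inv_on_words.
- exact: slide_inv_on_words.
- by move=> a b c; apply: cut_triangle.
- move=> x' y' t' sx sy st nxyt; apply: (on_words_triangle tpsi) => //.
  + apply: leq_trans wn; rewrite /unlinked_triangle /= !ltnS !size_cat /= !size_cat /=.
    have := size_subseq_leqif sx; have := size_subseq_leqif sy.
    have := size_subseq_leqif st => -[lt et] [ly ey] [lx ex].
    have : [|| x' != x, y' != y | t' != t].
      rewrite -!negb_and; apply/negP => /and3P[/eqP xx /eqP yy /eqP tt].
      by apply: nxyt; rewrite xx yy tt.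
    by rewrite -ex -ey -et => h; apply: ltn_add3 lx ly lt h.
  + apply: subseq_uniq uw; rewrite /unlinked_triangle.
    rewrite -[mate o :: _]/([:: mate o; q] ++ _) -[X in _ ++ X]/(x' ++ [:: mate q; r] ++ y' ++ [:: mate r; o] ++ t').
    rewrite -[X in subseq _ X]/([:: mate o; q] ++ x ++ [:: mate q; r] ++ y ++ [:: mate r; o] ++ t).
    by rewrite !cat_subseq.
Qed.

Lemma expand_clean wt (g : seq endpoint -> B) (w : seq endpoint) : droppable g ->
  expand wt g g w = expand wt g g (clean w).
Proof.
move=> gd; apply: (droppable_clean (g := fun s => expand wt g g s)).
by move=> x b y nb; apply: expand_drop_id.
Qed.

(** Up to rotation, removing the arrows met by the arc from [b] to [a] leaves the arrows
    of the complementary arc [p1]; the remaining endpoints of [p1] have no mate there. *)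
Lemma knot_sum_remove psi (D : diagram) k a b p1 p2 sg : homeo_invariant psi ->
  rot k D = a :: p1 ++ b :: p2 -> b = mate a ->
  knot_sum psi sg (remove_arrows (b :: rcons p2 a) D) =
  state_sum (fun i => Some (sg i)) (on_words psi) p1.
Proof.
move=> hpsi rE ba; set S := b :: rcons p2 a.
have uD := gauss_uniq (endpointsP D).
have uR : uniq (a :: p1 ++ b :: p2) by rewrite -rE rot_uniq.
have mR (l : endpoint) : l \in a :: p1 ++ b :: p2 -> mate l \in a :: p1 ++ b :: p2.
  by rewrite -rE !mem_rot gauss_mate // endpointsP.
rewrite /knot_sum /remove_arrows /=.
set P := fun x : endpoint => (arrow_tail x.1 \notin S) && (arrow_head x.1 \notin S).
have PE (l : endpoint) : P l = (l \notin S) && (mate l \notin S).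
  by case: l => i []; rewrite /P //= andbC.
have -> : remove_word S D = filter P D by [].
rewrite -[in filter P D](cat_take_drop k D) filter_cat
  (state_sum_catC _ (rot_inv_on_words hpsi)); last first.
  by rewrite -filter_cat cat_take_drop filter_uniq.
rewrite -filter_cat -/(rot k D) rE /state_sum (expand_clean _ p1 (@on_words_droppable _ psi)).
congr (mean (expand _ _ _ _)).
have Sb : S =i [:: a, b & p2] by move=> l; rewrite !inE mem_rcons inE orbCA.
have nS l : l \in S -> P l = false by rewrite PE => ->.
rewrite -[a :: _]/([:: a] ++ _) filter_cat /= nS ?Sb ?mem_head // filter_cat /=.
rewrite nS ?Sb ?inE ?eqxx ?orbT // (_ : filter P p2 = [::]) ?cats0; last first.
  rewrite -(filter_pred0 p2); apply: eq_in_filter => l l2.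
  by rewrite nS // Sb !inE l2 !orbT.
apply: eq_in_filter => l l1; rewrite PE.
have nl : l \notin S.
  rewrite Sb; move: uR; rewrite -cat1s uniq_catCA catA.
  rewrite (perm_uniq (_ : perm_eq _ (p1 ++ [:: a, b & p2]))); last by perm_by_count.
  by rewrite cat_uniq => /and3P[_ /hasPn h _]; apply/negP => /h; rewrite l1.
rewrite nl /= Sb; apply/idP/idP => [nm|m1].
  have := mR l; rewrite !(inE, mem_cat) l1 !orbT => /(_ isT).
  by move: nm; rewrite !inE !negb_or => /and3P[/negbTE-> /negbTE-> /negbTE->]; rewrite /= orbF.
move: uR; rewrite (perm_uniq (_ : perm_eq _ (p1 ++ [:: a, b & p2]))); last by perm_by_count.
by rewrite cat_uniq => /and3P[_ /hasPn h _]; apply/negP => /h; rewrite m1.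
Qed.

Lemma knot_sum_skein psi (D : diagram) e : homeo_invariant psi ->
  arrow_tail e \in endpoints D -> sign D e = true ->
  knot_sum psi (sign D) D - knot_sum psi (sign (negate_sign D e)) D =
  'X *: (knot_sum psi (sign D) (skein_left D e) * knot_sum psi (sign D) (skein_right D e)).
Proof.
move=> hpsi eD se; have uD := gauss_uniq (endpointsP D).
have hD : arrow_head e \in endpoints D.
  by rewrite -(gauss_mate _ (endpointsP D)).
have ne : arrow_tail e != arrow_head e by rewrite -pair_eqE /= eqxx.
have [k p1 p2 a1 a2 rE] := rot_to_arc uD eD hD ne.
have rE' : rot (size (arrow_tail e :: p1)) (rot k D) = arrow_head e :: p2 ++ arrow_tail e :: p1.
  by rewrite rE -[_ :: p1 ++ _]/((_ :: p1) ++ _) rot_size_cat.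
rewrite /skein_left /skein_right /closed_arc -a1 -a2.
rewrite (knot_sum_remove _ hpsi rE) //.
have [k' rE''] : exists k', rot k' D = arrow_head e :: p2 ++ arrow_tail e :: p1.
  by exists (rot_add D k (size (arrow_tail e :: p1))); rewrite -rot_rot_add.
rewrite (knot_sum_remove _ hpsi rE'') //.
have uR : uniq (arrow_tail e :: p1 ++ mate (arrow_tail e) :: p2).
  by rewrite -[_ :: _]rE rot_uniq.
have rotE wt : state_sum wt (on_words psi) D =
    state_sum wt (on_words psi) (arrow_tail e :: p1 ++ mate (arrow_tail e) :: p2).
  rewrite -[in LHS](cat_take_drop k D) state_sum_catC ?cat_take_drop //.
    by rewrite -/(rot k D) rE.
  exact: rot_inv_on_words.
rewrite /knot_sum !rotE; apply: state_sum_skein => //=.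
- by rewrite se.
- by rewrite eqxx.
- by move=> i /negbTE ->.
Qed.

End Steps.

(** * Lifting strings to the skein algebra *)

Lemma skein_class_equiv D D' : knot_equiv D D' -> skein_class D = skein_class D'.
Proof.
move=> DD; rewrite /skein_class /knot_gen; 
suff -> : \pi_virtual_knot D = \pi_virtual_knot D' by [].
by apply/eqquotP/asboolP.
Qed.

Lemma skein_class_step D D' : diagram_step D D' -> skein_class D = skein_class D'.
Proof. by move=> st; apply/skein_class_equiv/rst_step. Qed.

Lemma skein_generator_in x : skein_generator x -> x \in skein_ideal.
Proof.
move=> gx; apply/asboolP; exists [:: (1, x)]; rewrite big_seq1 mul1r; split=> //.
by move=> p; rewrite inE => /eqP ->.
Qed.

Lemma pi_skein_eq0 x : x \in skein_ideal -> \pi_skein_algebra x = 0.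
Proof. 
move=> xI; rewrite -(rmorph0 \pi_skein_algebra); apply/eqP.
by rewrite -Quotient.idealrBE subr0.
Qed.

Lemma skein_class_trivial sg : skein_class (Diagram trivial_string sg) = 0.
Proof.
rewrite -(pi_skein_eq0 (skein_generator_in SkeinTrivial)) /trivial_knot.
apply: skein_class_step; apply: (@DiagramHomeo _ _ id) => //.
by split=> //; exists 0%N.
Qed.

Lemma skein_class_skein (D : diagram) e : arrow_tail e \in endpoints D -> sign D e = true ->
  skein_class D - skein_class (negate_sign D e) =
  'X *: (skein_class (skein_left D e) * skein_class (skein_right D e)).
Proof.
move=> eD se; have := pi_skein_eq0 (skein_generator_in (SkeinRelation eD se)).
have piB (x y : polyalg virtual_knot) :
  \pi_skein_algebra (x - y) = \pi_skein_algebra x - \pi_skein_algebra y.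
  exact: rmorphB.
rewrite /skein_relation !piB pi_skeinZ => /eqP; rewrite subr_eq0 => /eqP ->.
by congr skein_scale; exact: rmorphM.
Qed.

Lemma skein_class_same_signs (v : vstring) sg sg' :
  (forall i, arrow_tail i \in endpoints v -> sg' i = sg i) ->
  skein_class (Diagram v sg) = skein_class (Diagram v sg').
Proof.
move=> sE; apply: skein_class_step; apply: (@DiagramHomeo _ _ id) => //.
split=> //; exists 0%N; rewrite rot0 (eq_map (g := id)) ?map_id //.
by case.
Qed.

Definition truncate (n : nat) (psi : vstring -> skein_algebra) (v : vstring) :=
  if (size v < n)%N then psi v else 0.

(** By [knot_sum_truncate], a fixed point of this operator has the classes of positive
    diagrams as its state sums; the truncation makes it contractive for the rank. *)
Definition string_lift_step (psi : vstring -> skein_algebra) (v : vstring) :=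
  skein_class (Diagram v xpredT) - knot_sum (truncate (size v) psi) xpredT v.

Definition string_lift (v : vstring) : skein_algebra :=
  iter (size v).+1 string_lift_step (fun=> 0) v.

Lemma string_liftE v : string_lift v = string_lift_step string_lift v.
Proof.
have stab n m (u : vstring) : (size u < n)%N -> (size u < m)%N ->
    iter n string_lift_step (fun=> 0) u = iter m string_lift_step (fun=> 0) u.
  elim: n m u => // n IHn [|m] u // un um; rewrite /= /string_lift_step.
  congr (_ - knot_sum _ _ _); apply/funext => w; rewrite /truncate; case: ifP => // wu.
  by apply: IHn; exact: leq_trans wu _.
rewrite {1}/string_lift /= /string_lift_step; congr (_ - knot_sum _ _ _).
apply/funext => w; rewrite /truncate; case: ifP => // wu.
exact: stab.
Qed.

Lemma knot_sum_truncate psi sg (v : vstring) :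
  knot_sum psi sg v = knot_sum (truncate (size v) psi) sg v + psi v.
Proof.
rewrite /knot_sum /state_sum -[X in _ = _ + X]meanC -meanD; congr mean.
have tE q : subseq q v -> on_words psi q = on_words (truncate (size v) psi) q +
    (if q == v :> seq endpoint then psi v else 0).
  move=> qv; case: eqP => [->|nqv].
    by rewrite !on_wordsK /truncate ltnn add0r.
  by rewrite addr0 /on_words /truncate (leq_ltn_trans (size_cleaned _)) // size_subseq_lt.
apply: expand_congr => // q qv nqv.
by rewrite tE //; case: eqP => // _; rewrite addr0.
Qed.

Lemma knot_sum_positive v : knot_sum string_lift xpredT v = skein_class (Diagram v xpredT).
Proof. by rewrite knot_sum_truncate [string_lift v]string_liftE /string_lift_step subrKC. Qed.

Lemma string_lift_trivial : string_lift trivial_string = 0.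
Proof.
rewrite string_liftE /string_lift_step skein_class_trivial /knot_sum /state_sum.
by rewrite expand_nil on_words_nil /truncate /= meanC subrr.
Qed.

(** The difference of the two state sums is the difference of the leading terms, and it
    vanishes since both diagrams represent the same knot. *)
Lemma string_lift_homeo : homeo_invariant string_lift.
Proof.
elim=> // n IHn f v w; rewrite ltnS => vn fvw.
have := knot_sum_homeo (sg := xpredT) (sg' := xpredT) IHn vn fvw (fun _ _ => erefl).
rewrite !knot_sum_positive.
have -> : skein_class (Diagram v xpredT) = skein_class (Diagram w xpredT).
  by apply: skein_class_step; apply: (@DiagramHomeo _ _ f).
by rewrite -{1}[skein_class _]addr0 => /addrI /esym /subr0_eq.
Qed.

Lemma eq_knot_sum (B : comAlgType {poly rat}) (psi : vstring -> B) sg sg' (v : vstring) :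
  (forall i, arrow_tail i \in endpoints v -> sg i = sg' i) ->
  knot_sum psi sg v = knot_sum psi sg' v.
Proof.
move=> sE; congr mean; apply: eq_expand_wt => -[i b] iv _; congr Some; apply: sE.
by case: b iv => //; rewrite -(gauss_mate _ (endpointsP v)).
Qed.

Lemma size_remove_arrows s (D : diagram) (e : endpoint) : e \in endpoints D -> e \in s ->
  (size (remove_arrows s D) < size D)%N.
Proof.
move=> eD es; rewrite /remove_arrows /remove_word /= size_filter
  -(count_predC (fun x : endpoint => (arrow_tail x.1 \notin s) && (arrow_head x.1 \notin s)) D).
rewrite -[X in (X < _)%N]addn0 ltn_add2l -has_count; apply/hasP; exists e => //=.
by case: e es {eD} => i [] /= ->; rewrite ?andbF.
Qed.

(** Induction on the number of endpoints, then on the number of negative arrows: the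
    skein relation of a negative arrow, satisfied by both sides, reduces to fewer
    negative arrows and to smaller diagrams. *)
Lemma knot_sum_lift D : knot_sum string_lift (sign D) D = skein_class D.
Proof.
have [n] := ubnP (size D); elim: n D => // n IHn D.
pose negs (D : diagram) := count (fun x : endpoint => x.2 && ~~ sign D x.1) D.
have [m] := ubnP (negs D); elim: m D => // m IHm D; rewrite !ltnS => lem len.
have [/hasP[[i b] iD /andP[/= bT si]]|/hasPn pos] :=
    boolP (has (fun x : endpoint => x.2 && ~~ sign D x.1) D); last first.
  have sE i : arrow_tail i \in endpoints D -> sign D i = true.
    by move=> /pos /= /negPn.
  rewrite (eq_knot_sum _ (sg' := xpredT)) // knot_sum_positive.
  by case: D sE {lem len pos} => v sg sE; apply: skein_class_same_signs => j /sE.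
rewrite {}bT in iD *.
(* [D] is obtained from the diagram [D'] by making the arrow [i] negative. *)
pose D' := Diagram D [eta sign D with i |-> true].
have ND : negate_sign D' i = D.
  case: D @D' si {iD lem len} => v sg /= si; congr Diagram; apply/funext => j /=.
  by case: eqP => // ->; rewrite (negbTE si).
have iD' : arrow_tail i \in endpoints D' by [].
have si' : sign D' i = true by rewrite /= eqxx.
have := knot_sum_skein string_lift_homeo iD' si'.
have := skein_class_skein iD' si'; rewrite ND.
have hD : arrow_head i \in endpoints D by rewrite -(gauss_mate _ (endpointsP D)).
have -> : knot_sum string_lift (sign D') D' = skein_class D'.
  apply: IHm => //; apply: leq_trans lem; rewrite /negs /=.
  set a' := fun x : endpoint => _; set a := fun x : endpoint => _.
  have := count_predUI a' (pred1 (i, true)) D.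
  rewrite (@eq_count _ (predU _ _) a); last first.
    move=> [j c]; rewrite /a /a' /= -pair_eqE /=; case: eqP => [->|_]; last by rewrite orbF.
    by rewrite si; case: c.
  rewrite (@eq_count _ (predI _ _) pred0) ?count_pred0; last first.
    move=> [j c]; rewrite /a' /= -pair_eqE /=; case: eqP => _; last by rewrite andbF.
    by case: c.
  rewrite addn0 => ->; rewrite -[X in (X < _)%N]addn0 ltn_add2l.
  by rewrite -has_count has_pred1.
have -> : knot_sum string_lift (sign D') (skein_left D' i) = skein_class (skein_left D' i).
  apply: IHn; apply: leq_trans len; apply: (size_remove_arrows (e := arrow_tail i)) => //.
  by rewrite /closed_arc mem_rcons mem_head.
have -> : knot_sum string_lift (sign D') (skein_right D' i) = skein_class (skein_right D' i).
  apply: IHn; apply: leq_trans len; apply: (size_remove_arrows (e := arrow_head i)) => //.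
  by rewrite /closed_arc mem_rcons mem_head.
by move=> <- /addrI /oppr_inj.
Qed.

Lemma string_lift_of_step v w sg : skein_class (Diagram v sg) = skein_class (Diagram w sg) ->
  knot_sum string_lift sg w = knot_sum string_lift sg v + (string_lift w - string_lift v) ->
  string_lift w = string_lift v.
Proof.
move=> vw; rewrite (knot_sum_lift (Diagram v sg)) (knot_sum_lift (Diagram w sg)) -vw.
by rewrite -{1}[skein_class _]addr0 => /addrI /esym /subr0_eq.
Qed.

Lemma gauss_perm w w' : perm_eq w w' -> gauss w -> gauss w'.
Proof.
move=> ww; rewrite /gauss (perm_uniq ww) => /andP[-> h] /=.
apply/allP => e; rewrite -(perm_mem ww) => ew; rewrite -(perm_mem ww).
exact: (allP h).
Qed.

Lemma gauss_kink e w : gauss w -> e \notin w -> gauss (e :: mate e :: w).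
Proof.
move=> gw ew; have e'w : mate e \notin w by rewrite gauss_mate.
rewrite gaussE clean_kink /= ?cleanK // !inE negb_or ew e'w eq_sym mate_neq gauss_uniq //.
by rewrite eqxx.
Qed.

Lemma fresh_arrow (w : seq endpoint) : exists j, forall b, (j, b) \notin w.
Proof.
exists (\max_(l <- w) l.1).+1 => b; apply/negP => jw.
by have := @leq_bigmax_seq _ w predT (fun l : endpoint => l.1) _ jw isT; rewrite ltnn.
Qed.

Lemma map_id_arrow (w : seq endpoint) : [seq (x.1, x.2) | x <- w] = w.
Proof. by rewrite (eq_map (g := id)) ?map_id //; case. Qed.

Lemma knot_equiv_rot n (v w : vstring) sg : w = rot n v :> seq endpoint ->
  knot_equiv (Diagram v sg) (Diagram w sg).
Proof.
move=> wE; apply/rst_step/(@DiagramHomeo _ _ id) => //.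
by split=> //; exists n; rewrite map_id_arrow.
Qed.

Lemma knot_equiv_same_signs (v : vstring) sg sg' :
  (forall i, arrow_tail i \in endpoints v -> sg' i = sg i) ->
  knot_equiv (Diagram v sg) (Diagram v sg').
Proof.
move=> sE; apply/rst_step/(@DiagramHomeo _ _ id) => //.
by split=> //; exists 0%N; rewrite rot0 map_id_arrow.
Qed.

(** If [e] is a head, the kink is obtained by adding a pair of opposite arrows by move (b),
    a new arrow [j] and the arrow of [e], placed so that [j] becomes a kink of the first
    type, which move (a) removes. *)
Lemma knot_equiv_kink e (v w : vstring) sg : w = e :: mate e :: v :> seq endpoint ->
  knot_equiv (Diagram v sg) (Diagram w sg).
Proof.
case: e => i [] wE; first by apply/rst_step/(@DiagramMoveA _ _ i).
have gw := endpointsP w; rewrite wE in gw.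
have [j jw] := fresh_arrow w.
have jw1 : (j, true) \notin [:: (i, false), mate (i, false) & v] by rewrite -wE.
pose u := [:: (i, false), (j, true), (j, false), (i, true) & endpoints v].
have gu : gauss u by apply: gauss_perm (gauss_kink gw jw1); rewrite /u /mate /=; perm_by_count.
pose u' := [:: (j, true), (j, false), (i, true) & rcons v (i, false)].
have gu' : gauss u' by apply: gauss_perm gu; rewrite /u /u'; perm_by_count.
pose w' := (i, true) :: rcons v (i, false).
have gw' : gauss w' by apply: gauss_perm gw; rewrite /w' /mate /=; perm_by_count.
(* The arrows added by move (b) have opposite signs; the sign of [j] is free outside [w]. *)
pose sg' := [eta sg with j |-> ~~ sg i].
have sgE x : (forall b, (x, b) \in endpoints w -> sg' x = sg x).
  move=> b xw; rewrite /sg' /=; case: eqP => // xj.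
  by move: xw; rewrite xj (negbTE (jw b)).
have vw (l : endpoint) : l \in endpoints v -> l \in endpoints w by rewrite wE !inE => ->; rewrite !orbT.
have nij : i != j.
  by apply/eqP => ij; have := jw true; rewrite wE ij !inE eqxx orbT.
apply: (rst_trans _ _ _ (Diagram (VString gu) sg')).
  apply/rst_step/(@DiagramMoveB _ _ j i).
  - exists [:: (i, false); (j, true)], [:: (j, false); (i, true)], [::], (endpoints v).
    by split=> //; perm_by_count.
  - by move=> k kv; apply: (sgE _ true); apply: vw.
  - by rewrite /sg' /= eqxx (negbTE nij) negbK.
apply: (rst_trans _ _ _ (Diagram (VString gu') sg')).
  by apply: (@knot_equiv_rot 1); rewrite /u' /= /rot /= cats1.
apply: (rst_trans _ _ _ (Diagram (VString gw') sg')).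
  by apply/rst_sym/rst_step/(@DiagramMoveA _ _ j).
apply: (rst_trans _ _ _ (Diagram w sg')).
  apply/rst_sym/(@knot_equiv_rot 1); rewrite /= wE /w' /= /rot /= cats1 //.
by apply/rst_sym/knot_equiv_same_signs => k kw; apply: (sgE _ true).
Qed.

Lemma knot_equiv_slide e f x t y (v w : vstring) sg : e.2 != f.2 ->
  perm_eq t [:: mate e; mate f] ->
  w = e :: f :: x ++ t ++ y :> seq endpoint -> v = x ++ y :> seq endpoint ->
  sg f.1 = ~~ sg e.1 -> knot_equiv (Diagram v sg) (Diagram w sg).
Proof.
case: e f => i [] [j []] //= _ pt wE vE sgE; apply/rst_step.
  apply: (@DiagramMoveB _ _ i j) => //.
  by exists [:: (i, true); (j, false)], t, x, y.
apply: (@DiagramMoveB _ _ j i) => //; last by rewrite /= sgE negbK.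
exists [:: (i, false); (j, true)], t, x, y; split=> //; first by perm_by_count.
by apply: perm_trans pt _; rewrite /mate /=; perm_by_count.
Qed.

Lemma knot_equiv_triangle o q r x y t (v w : vstring) sg :
  o.2 = q.2 -> q.2 = r.2 -> triangle_signs o q r sg ->
  w = unlinked_triangle o q r x y t :> seq endpoint ->
  v = linked_triangle o q r x y t :> seq endpoint ->
  knot_equiv (Diagram v sg) (Diagram w sg).
Proof.
case: o q r => k b [i c] [j d] /= -> ->; rewrite /triangle_signs /=.
case: d => -[sk si sj] wE vE.
  apply/rst_sym/rst_step/(@DiagramMoveC _ _ i j k) => //.
  by exists x, y, t; left; rewrite /= wE vE.
apply/rst_step/(@DiagramMoveC _ _ k j i) => //.
by exists x, y, t; right; rewrite /= wE vE.
Qed.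

(** Induction on the number of endpoints, as in [string_lift_homeo]; likewise below. *)
Lemma string_lift_kink : kink_invariant string_lift.
Proof.
elim=> // n IHn e v w; rewrite ltnS => wn wE.
apply: (string_lift_of_step (sg := xpredT)); first exact/skein_class_equiv/(knot_equiv_kink _ wE).
exact: knot_sum_kink string_lift_trivial IHn wn wE.
Qed.

(** Any move of strings lifts to a move of diagrams for suitable signs. *)
Lemma slide_signs e f x t y (w : vstring) : e.2 != f.2 ->
  perm_eq t [:: mate e; mate f] -> w = e :: f :: x ++ t ++ y :> seq endpoint ->
  exists sg : nat -> bool, sg f.1 = ~~ sg e.1.
Proof.
move=> ef pt wE; exists [eta xpredT with f.1 |-> false].
have nef : e.1 != f.1.
  apply: neq_arrow; first by apply: contraNneq ef => ->.
  have := gauss_uniq (endpointsP w); rewrite wE /= => /and3P[_ + _].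
  by apply: contraNneq => <-; rewrite !mem_cat (perm_mem pt) !inE eqxx !orbT.
by rewrite /= eqxx (negbTE nef).
Qed.

Lemma string_lift_slide : slide_invariant string_lift.
Proof.
elim=> // n IHn e f x t y v w; rewrite ltnS => wn ef pt wE vE.
have [sg sgE] := slide_signs ef pt wE.
apply: (string_lift_of_step (sg := sg)).
  exact/skein_class_equiv/(knot_equiv_slide ef pt wE vE).
exact: knot_sum_slide string_lift_trivial string_lift_homeo string_lift_kink IHn wn ef pt wE vE sgE.
Qed.

Lemma triangle_signs_exist o q r : o.1 != q.1 -> q.1 != r.1 -> o.1 != r.1 ->
  exists sg, triangle_signs o q r sg.
Proof.
move=> oq qr or; exists (fun i => if o.2 then i != o.1 else i != q.1).
rewrite /triangle_signs; case: o.2; rewrite ?eqxx.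
  by rewrite ![_ == o.1]eq_sym oq or.
by rewrite oq eq_sym qr.
Qed.

Lemma unlinked_triangle_arrows o q r x y t : uniq (unlinked_triangle o q r x y t) ->
  [/\ o.1 != q.1, q.1 != r.1 & o.1 != r.1].
Proof.
move=> uN; have u6 : uniq ([:: o; mate o; q; mate q; r; mate r] ++ x ++ y ++ t).
  by move: uN; rewrite /unlinked_triangle => h; uniq_from h.
move: u6; rewrite /= !inE !mem_cat !negb_or.
case/and5P => /and5P[_ oq oq' or_ /andP[or' _]] _ /and5P[_ qr qr' _ _] _ _.
by split; apply: neq_arrow; rewrite ?mate_eq.
Qed.

Lemma string_lift_triangle : forall n, triangle_inv_below n string_lift.
Proof.
elim=> // n IHn o q r x y t v w; rewrite ltnS => wn oq qr wE vE.
have [noq nqr nor] : [/\ o.1 != q.1, q.1 != r.1 & o.1 != r.1].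
  by apply: (@unlinked_triangle_arrows o q r x y t); rewrite -wE gauss_uniq ?endpointsP.
have [sg sgE] := triangle_signs_exist noq nqr nor.
apply: (string_lift_of_step (sg := sg)).
  exact/skein_class_equiv/(knot_equiv_triangle oq qr sgE wE vE).
exact: knot_sum_triangle string_lift_trivial string_lift_homeo string_lift_kink
  string_lift_slide IHn wn oq qr sgE wE vE.
Qed.

(** * Morphisms of polynomial algebras and state sums *)

Lemma cmonom_ind (T : choiceType) (P : {cmonom T} -> Prop) :
  P mone -> (forall i m, P m -> P (mmul (ucm i) m)) -> forall m, P m.
Proof.
move=> P1 PM m; have [n] := ubnP (mdeg m); elim: n m => // n IHn m.
rewrite ltnS => mn; case: (fset_0Vmem (finsupp m)) => [m0|[k km]].
  suff -> : m = mone by [].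
  by apply/mdeg_eq0I; rewrite mdegE m0 big_seq_fset0.
have mE : m = mmul (ucm k) (divcm m (ucm k)).
  apply/eqP/cmP => i; rewrite cmM divcmE cmU; case: eqP => [<-|_]; last by rewrite subn0.
  by rewrite subnKC // lt0n cmE_neq0.
rewrite mE; apply/PM/IHn; move: mn; rewrite {1}mE mdegM mdegU add1n.
exact: leq_trans.
Qed.

Section Evaluation.
Variables (T : choiceType) (S : comAlgType {poly rat}) (phi : T -> S).

Definition monom_eval (m : {cmonom T}) : S := \prod_(k <- finsupp m) phi k ^+ m k.

Lemma monom_evalEw (m : {cmonom T}) (d : {fset T}) : (finsupp m `<=` d)%fset ->
  monom_eval m = \prod_(k <- d) phi k ^+ m k.
Proof.
move=> le; rewrite /monom_eval (big_fset_incl _ le) // => k _.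
by rewrite -cmE_neq0 negbK => /eqP ->; rewrite expr0.
Qed.

Lemma monom_eval_morph : mmorphism monom_eval.
Proof.
split=> [m1 m2 /=|]; last by rewrite /monom_eval mdom1 big_seq_fset0.
rewrite {1}/monom_eval mdomD (monom_evalEw (fsubsetUl _ (finsupp m2)))
  (monom_evalEw (fsubsetUr (finsupp m1) _)) -big_split /=.
by apply: eq_bigr => k _; rewrite cmM exprD.
Qed.
HB.instance Definition _ := isMultiplicative.Build {cmonom T} S monom_eval monom_eval_morph.

Definition poly_eval : polyalg T -> S := mmap (in_alg S) monom_eval.

HB.instance Definition _ := GRing.RMorphism.on poly_eval.

Lemma poly_evalZ a x : poly_eval (a *: x) = a *: poly_eval x.
Proof. by rewrite /poly_eval mmapZ /= mulr_algl. Qed.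

Lemma poly_eval_gen x : poly_eval (gen x) = phi x.
Proof.
rewrite /poly_eval /gen mmapU /= scale1r mul1r /monom_eval mdomU big_seq_fset1.
by rewrite cmUU expr1.
Qed.

End Evaluation.

Lemma gen_monom (T : choiceType) (m : {cmonom T}) i :
  << mmul (ucm i) m >> = gen i * << m >> :> polyalg T.
Proof.
rewrite /gen (malgMEw (@msuppU_le _ _ (ucm i) 1) (@msuppU_le _ _ m 1)).
by rewrite !big_seq_fset1 !mcoeffUU mulr1.
Qed.

Lemma scale_monom (T : choiceType) (c : {poly rat}) (m : {cmonom T}) :
  << c *g m >> = c *: << m >> :> polyalg T.
Proof.
apply/malgP => k; rewrite mcoeffZ.
have E (a : {poly rat}) : (<< a *g m >> : polyalg T)@_k = a *+ (m == k).
  exact: mcoeffU.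
transitivity (c *+ (m == k)); first exact: E.
transitivity (c * (1 *+ (m == k))); first by rewrite mulrnAr mulr1.
by congr (_ * _); symmetry; exact: E.
Qed.

Lemma polyalg_morph_eq (T : choiceType) (S : comAlgType {poly rat})
    (F G : {rmorphism polyalg T -> S}) :
  (forall a x, F (a *: x) = a *: F x) -> (forall a x, G (a *: x) = a *: G x) ->
  (forall x, F (gen x) = G (gen x)) -> F =1 G.
Proof.
move=> FZ GZ FG x; rewrite [x]monalgE !rmorph_sum; apply: eq_bigr => m _ /=.
rewrite scale_monom FZ GZ; congr (_ *: _); elim/cmonom_ind: m => [|i m IH].
  by rewrite -[<< mone >>]/(1 : polyalg T) !rmorph1.
rewrite gen_monom (_ : F _ = F (gen i) * F << m >>); last exact: rmorphM.
rewrite (_ : G _ = G (gen i) * G << m >>); last exact: rmorphM.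
exact: (congr2 *%R (FG i) IH).
Qed.

Section Naturality.
Variables (A B : comAlgType {poly rat}) (F : {rmorphism A -> B}).
Hypothesis FZ : forall a x, F (a *: x) = a *: F x.

Lemma map_integ_below (p : {poly A}) : map_poly F (integ_below p) = integ_below (map_poly F p).
Proof.
apply/polyP=> i; rewrite coef_map !coef_integ_below; case: i => [|i]; first exact: rmorph0.
by rewrite coef_map; exact: FZ.
Qed.

Lemma map_mean (p : {poly A}) : mean (map_poly F p) = F (mean p).
Proof. by rewrite /mean -map_integ_below -[1 in LHS](rmorph1 F) horner_map. Qed.

Lemma map_integ_above (p : {poly A}) :
  map_poly F (integ_above p) = integ_above (map_poly F p).
Proof. by rewrite /integ_above rmorphB /= map_polyC /= map_integ_below map_mean. Qed.

Lemma map_cut wt e (p : {poly A}) : map_poly F (cut wt e p) = cut wt e (map_poly F p).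
Proof.
rewrite /cut; case: (wt _) => [b|]; last by rewrite rmorph0.
rewrite !rmorphM /= map_polyC /= FZ rmorph1 rmorph_sign.
by case: ifP; rewrite ?map_integ_below ?map_integ_above.
Qed.

Lemma map_expand wt g G s :
  map_poly F (expand wt g G s) = expand wt (F \o g) (F \o G) s.
Proof.
have [k] := ubnP (size s); elim: k s G => // k IHk [|e s] G /=.
  by rewrite !expand_nil map_polyC.
rewrite ltnS => lek.
have [es|es] := boolP (mate e \in s); last by rewrite !expand_keep ?IHk //; right.
have [s1 [s2 [defs es1]]] := split_first es; rewrite -> defs in *.
have lek' : (size (s1 ++ mate e :: s2) < k)%N by [].
rewrite size_cat /= in lek.
have [l1 l2] : (size s1 < k)%N /\ (size s2 < k)%N by split; lia.
by rewrite !expand_cut // rmorphD rmorphM /= map_cut !IHk.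
Qed.

(** State sums are natural in the algebra of values. *)
Lemma map_knot_sum psi sg v : F (knot_sum psi sg v) = knot_sum (F \o psi) sg v.
Proof. by rewrite /knot_sum /state_sum -map_mean map_expand. Qed.

End Naturality.

Lemma knot_sum_leading (B : comAlgType {poly rat}) (psi : vstring -> B) sg v :
  exists q, knot_sum psi sg v = psi v + 'X *: q.
Proof.
have [q qE] := expand_leading (fun i => Some (sg i)) (on_words psi) (on_words psi) v.
exists (mean q); rewrite /knot_sum /state_sum qE meanD meanC meanCM on_wordsK.
by rewrite mulr_algl.
Qed.


Lemma knot_sum_trivial (B : comAlgType {poly rat}) (psi : vstring -> B) sg :
  knot_sum psi sg trivial_string = psi trivial_string.
Proof. by rewrite /knot_sum /state_sum expand_nil on_words_nil meanC. Qed.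

Section StringClasses.
Variables (B : comAlgType {poly rat}) (psi : vstring -> B).
Hypotheses (psi_homeo : homeo_invariant psi) (psi_kink : kink_invariant psi).
Hypotheses (psi_slide : slide_invariant psi) (psi_triangle : forall n, triangle_inv_below n psi).

Lemma slide_of_move_b i j v w : move_b i j v w ->
  exists e f x t y, [/\ e.2 != f.2, perm_eq t [:: mate e; mate f],
    w = e :: f :: x ++ t ++ y, v = x ++ y & (e.1, f.1) = (i, j) \/ (e.1, f.1) = (j, i)].
Proof.
case=> s [t [x [y [ps pt vE wE]]]]; case: (perm_eq2 ps) => sE; rewrite sE /= in wE.
  by exists (i, true), (j, false), x, t, y; split=> //; left.
exists (j, false), (i, true), x, t, y; split=> //; last by right.
by apply: perm_trans pt _; rewrite /mate /=; perm_by_count.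
Qed.

(** The two cyclic orders of move (c) are the triangles named by tails and by heads. *)
Lemma homotopic_invariant v w : homotopic v w -> psi v = psi w.
Proof.
elim=> {v w} [v w|//|v w _ ->//|v u w _ -> _ ->//].
case=> [f fvw|i wE|i j|i j k].
- exact: psi_homeo (ltnSn _) fvw.
- by rewrite (psi_kink (ltnSn _) wE).
- case/slide_of_move_b=> e [f [x [t [y [ef pt wE vE _]]]]].
  by rewrite (psi_slide (ltnSn _) ef pt wE vE).
- case=> x [y [t [[vE wE]|[vE wE]]]].
    by rewrite (psi_triangle (ltnSn _) (o := (k, true)) (q := (i, true)) (r := (j, true)) _ _ vE wE).
  by rewrite (psi_triangle (ltnSn _) (o := (i, false)) (q := (k, false)) (r := (j, false)) _ _ wE vE).
Qed.

Hypothesis psi0 : psi trivial_string = 0.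

Lemma knot_sum_step (D D' : diagram) : diagram_step D D' ->
  knot_sum psi (sign D) D = knot_sum psi (sign D') D'.
Proof.
have same : same_signs D D' -> knot_sum psi (sign D) D = knot_sum psi (sign D') D.
  by move=> sE; apply: eq_knot_sum => i iD; rewrite sE.
case=> [f fDD sE|i wE sE|i j mb sE sij|i j k].
- rewrite (knot_sum_homeo (@psi_homeo (size D)) (leqnn _) fDD sE).
  by rewrite (psi_homeo (ltnSn _) fDD) subrr addr0.
- rewrite (knot_sum_kink (sign D') psi0 (@psi_kink (size D')) (leqnn _) wE) same //.
  by rewrite (psi_kink (ltnSn _) wE) subrr addr0.
- case/slide_of_move_b: mb => e [f [x [t [y [ef pt wE vE eij]]]]].
  have sef : sign D' f.1 = ~~ sign D' e.1.
    by case: eij => -[-> ->]; rewrite sij ?negbK.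
  rewrite (knot_sum_slide psi0 psi_homeo psi_kink (@psi_slide (size D')) (leqnn _) ef pt wE vE sef) same //.
  by rewrite (psi_slide (ltnSn _) ef pt wE vE) subrr addr0.
- case=> x [y [t [[vE wE]|[vE wE]]]] sE [si sj sk].
    have sg : triangle_signs (k, true) (i, true) (j, true) (sign D) by [].
    rewrite (knot_sum_triangle psi0 psi_homeo psi_kink psi_slide (@psi_triangle (size D)) (leqnn _)
      (erefl : (k, true).2 = (i, true).2) (erefl : (i, true).2 = (j, true).2) sg vE wE).
    rewrite (psi_triangle (ltnSn _) (o := (k, true)) (q := (i, true)) (r := (j, true)) _ _ vE wE) //.
    rewrite subrr addr0; apply: eq_knot_sum => l lD; rewrite sE // vE.
    move: lD; rewrite wE (@perm_mem _ _ (unlinked_triangle (k, true) (i, true) (j, true) x y t)) //.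
    by rewrite /unlinked_triangle; perm_by_count.
  (* Here [D] is the linked triangle and [D'] the unlinked one. *)
  have sg : triangle_signs (i, false) (k, false) (j, false) (sign D').
    split; rewrite sE ?si ?sj ?sk // vE;
    by rewrite !(inE, mem_cat) !eqxx ?orbT.
  rewrite (knot_sum_triangle (sg := sign D') psi0 psi_homeo psi_kink psi_slide (@psi_triangle (size D')) (leqnn _)
    (erefl : (i, false).2 = (k, false).2) (erefl : (k, false).2 = (j, false).2) sg wE vE).
  rewrite (psi_triangle (ltnSn _) (o := (i, false)) (q := (k, false)) (r := (j, false)) _ _ wE vE) //.
  by rewrite subrr addr0 same.
Qed.

End StringClasses.

(** * The isomorphism *)

Lemma diagram_step_homotopic (D D' : diagram) : diagram_step D D' -> homotopic D D'.
Proof.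
case=> [f fDD _|i wE _|i j wE _ _|i j k wE _ _]; apply: rst_step.
- exact: StringHomeo fDD.
- exact: StringMoveA wE.
- exact: StringMoveB wE.
- exact: StringMoveC wE.
Qed.

Lemma knot_equiv_homotopic (D D' : diagram) : knot_equiv D D' -> homotopic D D'.
Proof.
elim=> {D D'} [D D'|D|D D' _|D D' D'' _ + _].
- exact: diagram_step_homotopic.
- exact: rst_refl.
- exact: rst_sym.
- exact: rst_trans.
Qed.

Lemma string_gen_homotopic v w : homotopic v w -> string_gen v = string_gen w.
Proof.
move=> vw; rewrite /string_gen; suff -> : \pi_string_class v = \pi_string_class w by [].
by apply/eqquotP/asboolP.
Qed.

Lemma string_gen_trivial : string_gen trivial_string = 0.
Proof. by rewrite /string_gen insubF // eqxx. Qed.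

Lemma string_gen_homeo : homeo_invariant string_gen.
Proof. by move=> n f v w _ fvw; apply/string_gen_homotopic/rst_step/(StringHomeo fvw). Qed.

Lemma string_gen_kink : kink_invariant string_gen.
Proof.
move=> n e v w _ wE; symmetry; apply: string_gen_homotopic.
exact: (knot_equiv_homotopic (knot_equiv_kink xpredT wE)).
Qed.

Lemma string_gen_slide : slide_invariant string_gen.
Proof.
move=> n e f x t y v w _ ef pt wE vE; symmetry; apply: string_gen_homotopic.
have [sg sgE] := slide_signs ef pt wE.
exact: (knot_equiv_homotopic (knot_equiv_slide ef pt wE vE sgE)).
Qed.

Lemma string_gen_triangle n : triangle_inv_below n string_gen.
Proof.
move=> o q r x y t v w _ oq qr wE vE; symmetry; apply: string_gen_homotopic.
have [noq nqr nor] : [/\ o.1 != q.1, q.1 != r.1 & o.1 != r.1].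
  by apply: (@unlinked_triangle_arrows o q r x y t); rewrite -wE gauss_uniq ?endpointsP.
have [sg sgE] := triangle_signs_exist noq nqr nor.
exact: (knot_equiv_homotopic (knot_equiv_triangle oq qr sgE wE vE)).
Qed.

Lemma string_lift_homotopic v w : homotopic v w -> string_lift v = string_lift w.
Proof.
exact: homotopic_invariant string_lift_homeo string_lift_kink string_lift_slide
  string_lift_triangle v w.
Qed.

Definition knot_value (D : diagram) : string_algebra := knot_sum string_gen (sign D) D.

Lemma knot_value_equiv D D' : knot_equiv D D' -> knot_value D = knot_value D'.
Proof.
elim=> {D D'} [D D' st|D|D D' _ IH|D D' D'' _ IH1 _ IH2].
- rewrite /knot_value; apply: knot_sum_step st.
  + exact: string_gen_homeo.
  + exact: string_gen_kink.
  + exact: string_gen_slide.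
  + exact: string_gen_triangle.
  + exact: string_gen_trivial.
- exact: erefl.
- exact: esym IH.
- exact (etrans IH1 IH2).
Qed.

Definition knot_class_value (k : virtual_knot) : string_algebra := knot_value (repr k).

Lemma knot_class_valueE D : knot_class_value (\pi_virtual_knot D) = knot_value D.
Proof.
apply: knot_value_equiv; have /eqquotP/asboolP := reprK (\pi_virtual_knot D).
by [].
Qed.

(** State sums satisfy the skein relations and vanish on the trivial knot. *)
Lemma poly_eval_ideal x : x \in skein_ideal -> poly_eval knot_class_value x = 0.
Proof.
case/asboolP => s [sG ->]; rewrite rmorph_sum big_seq big1 // => p /sG pG.
transitivity (poly_eval knot_class_value p.1 * poly_eval knot_class_value p.2).
  exact: rmorphM.
suff -> : poly_eval knot_class_value p.2 = 0 by exact: mulr0.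
case: pG => [|D e eD se].
  apply: etrans (poly_eval_gen _ _) _; apply: etrans (knot_class_valueE _) _.
  exact: (etrans (knot_sum_trivial _ _) string_gen_trivial).
have genE D' : poly_eval knot_class_value (knot_gen D') = knot_value D'.
  exact: etrans (poly_eval_gen _ _) (knot_class_valueE _).
have skE := knot_sum_skein string_gen_homeo eD se.
have -> : poly_eval knot_class_value (skein_relation D e) =
    knot_value D - knot_value (negate_sign D e) -
    'X *: (knot_value (skein_left D e) * knot_value (skein_right D e)).
  rewrite /skein_relation -!genE.
  transitivity (poly_eval knot_class_value (knot_gen D - knot_gen (negate_sign D e)) -
    poly_eval knot_class_value ('X *: (knot_gen (skein_left D e) * knot_gen (skein_right D e)))).
    exact: rmorphB.
  congr (_ - _); first exact: rmorphB.
  apply: etrans (poly_evalZ _ _ _) _; congr (_ *: _); exact: rmorphM.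
by rewrite /knot_value skE subrr.
Qed.

Definition nabla (x : skein_algebra) : string_algebra :=
  poly_eval knot_class_value (repr x).

Lemma nabla_pi x : nabla (\pi_skein_algebra x) = poly_eval knot_class_value x.
Proof.
apply/eqP; rewrite -subr_eq0 -rmorphB; apply/eqP/poly_eval_ideal.
by rewrite Quotient.idealrBE reprK.
Qed.

Lemma skein_algebra_ind (P : skein_algebra -> Prop) :
  (forall x, P (\pi_skein_algebra x)) -> forall x, P x.
Proof. by move=> PP x; rewrite -[x]reprK. Qed.

Lemma nabla_zmod_morphism : zmod_morphism nabla.
Proof.
elim/skein_algebra_ind => x; elim/skein_algebra_ind => y.
have -> : \pi_skein_algebra x - \pi_skein_algebra y = \pi_skein_algebra (x - y).
  by symmetry; exact: rmorphB.
apply: etrans (nabla_pi _) _; apply: etrans (rmorphB _ _ _) _.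
exact: (congr2 (fun a b => a - b) (esym (nabla_pi x)) (esym (nabla_pi y))).
Qed.

Lemma nabla_monoid_morphism : monoid_morphism nabla.
Proof.
split.
  apply: (@etrans _ _ (nabla (\pi_skein_algebra 1))).
    by congr nabla; symmetry; exact: rmorph1.
  by apply: etrans (nabla_pi _) _; exact: rmorph1.
elim/skein_algebra_ind => x; elim/skein_algebra_ind => y.
have -> : \pi_skein_algebra x * \pi_skein_algebra y = \pi_skein_algebra (x * y).
  by symmetry; exact: rmorphM.
apply: etrans (nabla_pi _) _; apply: etrans (rmorphM _ _ _) _.
exact: (congr2 *%R (esym (nabla_pi x)) (esym (nabla_pi y))).
Qed.

Lemma nabla_scalable : scalable nabla.
Proof.
move=> a; elim/skein_algebra_ind => x.
have -> : a *: \pi_skein_algebra x = \pi_skein_algebra (a *: x).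
  by symmetry; exact: pi_skeinZ.
apply: etrans (nabla_pi _) _; apply: etrans (poly_evalZ _ _ _) _.
exact: (congr1 ( *:%R a) (esym (nabla_pi x))).
Qed.

HB.instance Definition _ :=
  GRing.isZmodMorphism.Build skein_algebra string_algebra nabla nabla_zmod_morphism.
HB.instance Definition _ :=
  GRing.isMonoidMorphism.Build skein_algebra string_algebra nabla nabla_monoid_morphism.
HB.instance Definition _ :=
  GRing.isScalable.Build {poly rat} skein_algebra string_algebra *:%R nabla nabla_scalable.

Lemma nabla_class D : nabla (skein_class D) = knot_value D.
Proof.
apply: etrans (nabla_pi _) _.
exact: etrans (poly_eval_gen _ _) (knot_class_valueE _).
Qed.

Definition unnabla : string_algebra -> skein_algebra :=
  poly_eval (fun c : nontrivial_string_class => string_lift (repr (val c))).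
HB.instance Definition _ := GRing.RMorphism.on unnabla.

Lemma unnabla_string_gen v : unnabla (string_gen v) = string_lift v.
Proof.
rewrite /string_gen; case: insubP => [c _ cE|/negPn/eqP v0].
  apply: etrans (poly_eval_gen _ _) _; apply: string_lift_homotopic.
  have : \pi_string_class (repr (val c)) = \pi_string_class v.
    exact: etrans (reprK _) cE.
  by move/eqquotP/asboolP.
apply: etrans (rmorph0 unnabla) _; rewrite -string_lift_trivial.
by apply/esym/string_lift_homotopic; move: v0 => /eqquotP/asboolP.
Qed.

(** By induction on the rank, all terms but the leading ones agree. *)
Lemma eq_of_knot_sum (B : comAlgType {poly rat}) (psi psi' : vstring -> B) sg :
  (forall v, knot_sum psi sg v = knot_sum psi' sg v) -> psi =1 psi'.
Proof.
move=> kE v; have [n] := ubnP (size v); elim: n v => // n IHn v; rewrite ltnS => vn.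
have := kE v; rewrite /knot_sum /state_sum.
have := @expand_congr _ (fun i => Some (sg i)) (fun i => Some (sg i)) (on_words psi)
  (on_words psi') (on_words psi) (on_words psi') (psi v - psi' v) v.
have small q : subseq q v -> q <> v :> seq endpoint -> on_words psi q = on_words psi' q.
  move=> qv nqv; apply: IHn; apply: leq_trans vn.
  by apply: leq_ltn_trans (size_cleaned _) _; apply: size_subseq_lt.
move=> -> //; first by rewrite meanD meanC -{2}[mean _]addr0 => /addrI /subr0_eq.
move=> q qv; case: eqP => [->|nqv]; first by rewrite !on_wordsK addrC subrK.
by rewrite addr0 small.
Qed.

(** Applied to the state sums of [string_lift], which are the classes of diagrams, [nabla]
    yields the state sums of [string_gen]. *)
Lemma nabla_string_lift : nabla \o string_lift =1 string_gen.
Proof.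
apply: (@eq_of_knot_sum _ _ _ xpredT) => v.
rewrite -(map_knot_sum (F := nabla)); last exact: nabla_scalable.
rewrite knot_sum_positive; exact: nabla_class.
Qed.

Lemma unnablaK : cancel unnabla nabla.
Proof.
move=> x; apply: (@polyalg_morph_eq _ _ (nabla \o unnabla) idfun).
- move=> a y; apply: etrans (nabla_scalable _ _); congr nabla; exact: poly_evalZ.
- by [].
move=> c /=; apply: (@etrans _ _ (nabla (string_lift (repr (val c))))).
  by congr nabla; exact: poly_eval_gen.
apply: etrans (nabla_string_lift _) _; rewrite /string_gen reprK.
case: insubP => [c' _ /val_inj -> //|]; by rewrite (valP c).
Qed.

Lemma nablaK : cancel nabla unnabla.
Proof.
elim/skein_algebra_ind => x; rewrite nabla_pi.
apply: (@polyalg_morph_eq _ _ (unnabla \o poly_eval knot_class_value) \pi_skein_algebra).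
- move=> a y; apply: etrans (poly_evalZ _ _ _); congr unnabla; exact: poly_evalZ.
- exact: pi_skeinZ.
move=> k; apply: (@etrans _ _ (unnabla (knot_class_value k))).
  by congr unnabla; exact: poly_eval_gen.
rewrite -[k]reprK knot_class_valueE /knot_value.
rewrite (map_knot_sum (F := unnabla)); last exact: poly_evalZ.
rewrite (_ : unnabla \o string_gen = string_lift); last first.
  by apply/funext => v; exact: unnabla_string_gen.
exact: knot_sum_lift.
Qed.

Theorem theorem9p3p1 :
  exists nabla : {lrmorphism skein_algebra -> string_algebra},
    bijective nabla /\
    forall D : diagram, exists q : string_algebra,
      nabla (skein_class D) = string_gen (underlying D) + 'X *: q.
Proof.
exists nabla; split; first by exists unnabla; [exact: nablaK|exact: unnablaK].
move=> D; have [q qE] := knot_sum_leading string_gen (sign D) D.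
by exists q; apply: etrans (nabla_class D) qE.
Qed.
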